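(* Let $X$ be a mixing shift of finite type, $Y$ a mixing sofic shift, and $\pi: X \to Y$ a factor code. Let $Z$ be a subshift with topological entropy $h(Z) < h(Y)$. Then there exists a subshift $Z' \subset X$ conjugate to $Z$ such that $\pi|_{Z'}$ is injective if and only if for every $n \geq 1$, the number of periodic points of least period $n$ in $Z$ is at most the number of periodic points $y \in Y$ of least period $n$ such that $y = \pi(x)$ for some periodic point $x \in X$ of least period $n$.
   Context: A subshift is a closed, shift-invariant subset of $\mathcal{A}^{\mathbb{Z}}$ for a finite alphabet $\mathcal{A}$ (product topology, shift $(\sigma x)_i = x_{i+1}$). For a subshift $S$, $\mathcal{B}(S)$ is its language (the finite words appearing in points of $S$) and $\mathcal{B}_n(S)$ the words in it of length $n$. A sliding block code is a continuous shift-commuting map between subshifts; a factor code is a surjective sliding block code; a conjugacy is a bijective one. A shift of finite type (SFT) is a subshift defined by a finite set of forbidden words; a sofic shift is a factor of an SFT. A subshift $S$ is strongly irreducible with gap $g \geq 1$ if for all $u,w \in \mathcal{B}(S)$ there is $v \in \mathcal{B}_g(S)$ with $uvw \in \mathcal{B}(S)$; ''mixing SFT'' and ''mixing sofic shift'' mean strongly irreducible SFT and strongly irreducible sofic shift. The entropy is $h(S) = \lim_{n} \frac1n \log |\mathcal{B}_n(S)|$. The least period of a periodic point $x$ is the least $n \geq 1$ with $\sigma^n x = x$. *)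

(* Defs.v *)
From HB Require Import structures.
From mathcomp Require Import all_boot all_order all_algebra.
From mathcomp Require Import all_classical all_reals all_analysis.

Set Implicit Arguments.
Unset Strict Implicit.
Unset Printing Implicit Defensive.

Import Order.TTheory GRing.Theory Num.Theory.

Local Open Scope classical_set_scope.
Local Open Scope ring_scope.

Definition fullshift (A : finType) : topologicalType :=
  {ptws int -> discrete_topology A}.

Definition shift_map (A : finType) (x : fullshift A) : fullshift A :=
  fun i => x (i + 1).

(* Invariance is the equality shift(S) = S, as usual for two-sided shifts.
   The empty subshift is allowed. *)
Definition subshift (A : finType) (S : set (fullshift A)) : Prop :=
  closed S /\ @shift_map A @` S = S.

(* The word x_i x_(i+1) ... x_(i+n-1). *)
Definition subword (A : finType) (x : fullshift A) (i : int) (n : nat) :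
    seq A :=
  mkseq (fun k : nat => x (i + k%:Z)) n.

Definition appears (A : finType) (w : seq A) (x : fullshift A) : Prop :=
  exists i : int, subword x i (size w) = w.

Definition language (A : finType) (S : set (fullshift A)) : set (seq A) :=
  [set w | exists2 x, S x & appears w x].

Definition languageN (A : finType) (S : set (fullshift A)) (n : nat) :
    set (seq A) :=
  [set w | language S w /\ size w = n].

(* |B_n(S)|; words of length n are enumerated as n-tuples. *)
Definition num_words (A : finType) (S : set (fullshift A)) (n : nat) : nat :=
  #|[pred t : n.-tuple A | tval t \in languageN S n]|.

(* The values are extended reals and lne 0 = -oo, so the empty subshift has
   entropy -oo; on nonempty subshifts the entropy is a nonnegative real. *)
Definition entropy (R : realType) (A : finType) (S : set (fullshift A)) :
    \bar R :=
  limn (fun n : nat => ((n%:R^-1)%:E * lne ((num_words S n)%:R%:E))%E).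

Definition sliding_block_code (A B : finType) (S : set (fullshift A))
    (T : set (fullshift B)) (f : fullshift A -> fullshift B) : Prop :=
  [/\ set_fun S T f,
      {within S, continuous f} &
      forall x, S x -> f (shift_map x) = shift_map (f x)].

Definition factor_code (A B : finType) (S : set (fullshift A))
    (T : set (fullshift B)) (f : fullshift A -> fullshift B) : Prop :=
  sliding_block_code S T f /\ set_surj S T f.

Definition conjugacy (A B : finType) (S : set (fullshift A))
    (T : set (fullshift B)) (f : fullshift A -> fullshift B) : Prop :=
  sliding_block_code S T f /\ set_bij S T f.

Definition conjugate (A B : finType) (S : set (fullshift A))
    (T : set (fullshift B)) : Prop :=
  exists f : fullshift A -> fullshift B, conjugacy S T f.

Definition SFT (A : finType) (S : set (fullshift A)) : Prop :=
  subshift S /\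
  exists F : seq (seq A),
    S = [set x | forall w : seq A, w \in F -> ~ appears w x].

Definition sofic (A : finType) (S : set (fullshift A)) : Prop :=
  subshift S /\
  exists (B : finType) (W : set (fullshift B))
    (f : fullshift B -> fullshift A), SFT W /\ factor_code W S f.

Definition strongly_irreducible_gap (A : finType) (S : set (fullshift A))
    (g : nat) : Prop :=
  (1 <= g)%N /\
  forall u w : seq A, language S u -> language S w ->
    exists2 v : seq A, languageN S g v & language S (u ++ v ++ w).

Definition strongly_irreducible (A : finType) (S : set (fullshift A)) : Prop :=
  exists g : nat, strongly_irreducible_gap S g.

Definition mixing_SFT (A : finType) (S : set (fullshift A)) : Prop :=
  SFT S /\ strongly_irreducible S.

Definition mixing_sofic (A : finType) (S : set (fullshift A)) : Prop :=
  sofic S /\ strongly_irreducible S.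

Definition least_period (A : finType) (x : fullshift A) (n : nat) : Prop :=
  [/\ (1 <= n)%N, iter n (@shift_map A) x = x &
      forall m : nat, (1 <= m < n)%N -> iter m (@shift_map A) x <> x].

Definition periodic_points (A : finType) (S : set (fullshift A)) (n : nat) :
    set (fullshift A) :=
  [set x | S x /\ least_period x n].

(* Main.v *)
From HB Require Import structures.
From mathcomp Require Import all_boot all_order all_algebra.
From mathcomp Require Import zify ring lra.
From mathcomp Require Import boolp.
Require Import Defs.
Set Implicit Arguments.
Unset Strict Implicit.
Unset Printing Implicit Defensive.
Import Order.TTheory GRing.Theory Num.Theory.

(** If Z embeds in X and the factor map pi is injective on the image, then pi
    after the embedding is injective and commutes with the shift, so it preserves
    least periods, and the comparison of periodic points follows.  Conversely it
    is enough to construct a sliding block code Psi from Z to X such that pi after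
    Psi is injective.  This is the construction in Krieger's embedding theorem,
    with the coding done in X and the decoding done from the image in Y.

    A shift of finite type is the set of sequences spelled by the bi-infinite
    paths of a finite graph ([spell_in], [path_exists]), and pi reads a label at
    each vertex ([label_exists]).  By strong irreducibility any two vertices are
    joined by walks of one fixed length G ([connections]).  As h(Z) < h(Y), for
    some length K there are more loops of length K at a fixed vertex alpha,
    distinguished by their labels, than words of length K in Z ([entropy_gap],
    [blockP]).  The blocks are a selection of these loops, slightly more than the
    words of length K in Z and still fewer than the available loops, together
    with one loop of length K + 1 that adjusts total lengths.  Concatenated blocks
    are numerous enough to store every long word of Z ([room_words]), and few
    enough for some label word u to occur in no concatenation of blocks
    ([rare_word]).

    The periodic points of Z are mapped to periodic paths by an equivariant map
    theta that is injective on labels, and u does not occur in the labels of its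
    values ([periodic_code]).  For small periods theta is the hypothesis on
    periodic points; for large ones there are enough periodic concatenations of
    blocks.  The word u is chosen after the bound between the two, and such that
    it occurs in no sequence of smaller period either.

    To code all of Z, positions are marked at distances at least N from each
    other, such that Z is locally of period less than N away from the marks
    ([marker_lemma]).  The code writes at each mark a marker word m that contains
    u twice.  In the rest of a short gap between marks it stores, in blocks, the
    word of Z at the gap.  In a long gap it follows the image under theta of the
    periodic point that Z imitates there.  A long gap needs no stored data: the
    periodic approximation holds beyond both of its ends, so the approximating
    point gives all letters of the gap.

    In the labels, u can occur only near a marker word or at a transition to or
    from a periodic part, and transitions are too short to meet two copies of u
    at the largest distance that occurs in m.  Hence the labels determine the
    marks ([mark_decode]); the blocks then give the letters in short gaps, and in
    a long gap the periodic part is seen on a stretch long enough to determine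
    it and, by injectivity of theta on labels, the approximating point
    ([code_inj]). *)

(** * Growth of exponentials *)

Section Arith.

(** Bernoulli's inequality for 1 + 1 / a, cleared of denominators. *)
Lemma bernoulli a i : i * a ^ i <= a * a.+1 ^ i.
Proof.
have H : a ^ i.+1 + i * a ^ i <= a * a.+1 ^ i.
  elim: i => [|i IH]; first by rewrite !expn0 expn1; lia.
  rewrite expnS [a.+1 ^ i.+1]expnS !(expnS a).
  move: IH; rewrite expnS; nia.
lia.
Qed.

(** The square of Bernoulli's inequality: (1 + 1 / a) ^ m grows at least
    quadratically, which beats every linear factor. *)
Lemma linear_mul_exp_le a c : 0 < a ->
  exists m0, forall m, m0 <= m -> c * m.+1 * a ^ m <= a.+1 ^ m.
Proof.
move=> a0.
exists (c * 4 * (a * a) + 4) .*2.+1 => m hm.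
pose i := m./2.
have Em : m = odd m + (i + i) by rewrite addnn odd_double_half.
have hi : c * 4 * (a * a) + 4 <= i by rewrite /i; lia.
have hb := bernoulli a i.
have hb2 : (i * a ^ i) * (i * a ^ i) <= (a * a.+1 ^ i) * (a * a.+1 ^ i).
  exact: leq_mul.
rewrite Em !expnD.
set A := a ^ i in hb2 *; set B := a.+1 ^ i in hb2 *.
have ho : a ^ odd m <= a.+1 ^ odd m by case: (odd m); rewrite ?expn0 ?expn1 //; lia.
rewrite -(leq_pmul2l (_ : 0 < a * a)) ?muln_gt0 ?a0 //.
apply: (@leq_trans (a.+1 ^ odd m * (i * A * (i * A)))); last first.
  apply: (@leq_trans (a.+1 ^ odd m * (a * B * (a * B)))); first by rewrite leq_mul2l hb2 orbT.
  by apply: eq_leq; lia.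
apply: (@leq_trans ((a * a * c * (odd m + (i + i)).+1) * (a ^ odd m * (A * A)))).
  by apply: eq_leq; lia.
apply: (@leq_trans ((i * i) * (a.+1 ^ odd m * (A * A)))); last by apply: eq_leq; lia.
apply: leq_mul; last by rewrite leq_mul2r ho orbT.
have : odd m <= 1 by case: (odd m).
nia.
Qed.

(** The numbers of block words of two families are compared through this: with
    one block more to choose from, a family stays larger after the loss of any
    fixed number d of blocks and against any linear factor. *)
Lemma poly_mul_exp_le a c d : 0 < a ->
  exists m0, forall m, m0 <= m -> c * m.+1 * a ^ (m + d) <= a.+1 ^ (m - d).
Proof.
move=> a0.
have [m0 h] := @linear_mul_exp_le a (c * d.+1 * a ^ (d + d)) a0.
exists (m0 + d) => m hm.
have {h} := h (m - d) ltac:(lia).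
apply: leq_trans.
have -> : m + d = (d + d) + (m - d) by lia.
rewrite expnD.
set X := a ^ (d + d); set Y := a ^ (m - d).
apply: (@leq_trans (c * (d.+1 * (m - d).+1) * (X * Y))); last by apply: eq_leq; lia.
rewrite leq_mul2r leq_mul2l; apply/orP; right; apply/orP; right; nia.
Qed.

End Arith.

(** * Walks and words of blocks *)

Section Walks.
Variables (V : finType) (e : rel V).
Implicit Types (s t : V) (l : seq V).

(** The end point t is not part of the word l, so that walks concatenate as
    words. *)
Definition walk s l t :=
  if l is x :: l' then (x == s) && path e x (rcons l' t) else s == t.

Lemma walk_cat s t r l1 l2 : walk s l1 t -> walk t l2 r -> walk s (l1 ++ l2) r.
Proof.
case: l1 => [/eqP->//|x l1] /= /andP[-> h1].
case: l2 => [/eqP<-|y l2] /=; first by rewrite cats0.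
move=> /andP[/eqP-> h2].
by rewrite rcons_cat /= -cat_rcons cat_path h1 last_rcons.
Qed.

Lemma walk_flatten s (ls : seq (seq V)) :
  (forall l, l \in ls -> walk s l s) -> walk s (flatten ls) s.
Proof.
elim: ls => [|l ls IH] h /=; first exact: eqxx.
apply: walk_cat; first by apply: h; rewrite inE eqxx.
by apply: IH => l' hl; apply: h; rewrite inE hl orbT.
Qed.

Lemma walk_edge d s l t i : walk s l t -> i < size l ->
  e (nth d l i) (nth d (rcons l t) i.+1).
Proof.
case: l => [//|x l] /= /andP[_ /pathP h] hi.
have := h d i; rewrite size_rcons => /(_ hi).
by rewrite -rcons_cons nth_rcons /= hi.
Qed.

Lemma walk_head d s l t : walk s l t -> nth d (rcons l t) 0 = s.
Proof. by case: l => [|x l] /= => [/eqP|/andP[/eqP]]. Qed.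

Lemma walk_path s p : path e s p -> walk s (belast s p) (last s p).
Proof.
case/lastP: p => [|p x]; first by rewrite /= eqxx.
by rewrite belast_rcons last_rcons /= eqxx.
Qed.

End Walks.

Section Flatten.
Variables (T : eqType) (BT : finType) (blk : BT -> seq T) (K K' : nat) (b0 : BT).
Hypothesis blk_ge : forall b, K <= size (blk b).
Hypothesis blk_le : forall b, size (blk b) <= K'.
Hypothesis K_gt0 : 0 < K.

Lemma size_flatten_ge bs : K * size bs <= size (flatten (map blk bs)).
Proof. by elim: bs => [|b bs IH] /=; rewrite ?muln0 // size_cat; move: (blk_ge b); lia. Qed.

(** Only the first and the last block that meet a factor can stick out of it,
    so a factor of length n meets at most n / K + 2 blocks. *)
Lemma factor_flatten bs j n : j + n <= size (flatten (map blk bs)) ->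
  exists i (w : (n %/ K + 2).-tuple BT), i <= K' /\
    take n (drop j (flatten (map blk bs))) =
    take n (drop i (flatten (map blk w))).
Proof.
elim: bs j => [|b bs IH] j /=.
  rewrite leqn0 addn_eq0 => /andP[_ /eqP->].
  by exists 0, (nseq_tuple _ b0); rewrite !take0.
rewrite size_cat; case: (ltnP j (size (blk b))) => hj hs.
- pose w := take (n %/ K + 2) (b :: bs) ++ nseq (n %/ K + 2 - size (b :: bs)) b0.
  have sw : size w == n %/ K + 2.
    by rewrite size_cat size_take size_nseq; case: ltnP; lia.
  exists j, (Tuple sw); split; first by have := blk_le b; lia.
  rewrite /w [tval _]/= -[blk b ++ _]/(flatten (map blk (b :: bs))).
  set bs' := b :: bs.
  have hsz : j + n <= size (flatten (map blk bs')) by rewrite /= size_cat.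
  case: (leqP (size bs') (n %/ K + 2)) => hh.
    rewrite (take_oversize hh) map_cat flatten_cat drop_cat.
    have : j < size (flatten (map blk bs')) by rewrite /= size_cat; lia.
    move=> ->; rewrite take_cat size_drop.
    case: (ltnP n) => // hn.
    have -> : n = size (flatten (map blk bs')) - j by lia.
    by rewrite subnn take0 cats0 take_oversize // size_drop.
  have -> : nseq (n %/ K + 2 - size bs') b0 = [::] by rewrite (_ : _ - _ = 0) //; lia.
  rewrite cats0 -{1}(cat_take_drop (n %/ K + 2) bs') map_cat flatten_cat.
  set t := take _ bs'.
  have ht : j + n <= size (flatten (map blk t)).
    have -> : t = b :: take (n %/ K).+1 bs by rewrite /t addn2.
    rewrite /= size_cat.
    have := size_flatten_ge (take (n %/ K).+1 bs).
    have -> : size (take (n %/ K).+1 bs) = (n %/ K).+1.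
      by rewrite size_takel //; move: hh; rewrite /bs' /=; lia.
    have := ltn_ceil n K_gt0; lia.
  rewrite drop_cat; case: ltnP => hjj.
    by rewrite take_cat size_drop; case: ltnP => // hn;
      rewrite (_ : n - _ = 0) ?take0 ?cats0 ?take_oversize ?size_drop //; lia.
  have n0 : n = 0 by lia.
  by rewrite n0 !take0.
- have /IH[i [w [hi E]]] : j - size (blk b) + n <= size (flatten (map blk bs)) by lia.
  exists i, w; split => //.
  by rewrite drop_cat ltnNge hj /=.
Qed.

End Flatten.

(** A factor is determined by its offset in the first block that it meets and
    by the names of the n / K + 2 blocks from there on. *)
Lemma card_factors_flatten (T BT : finType) (blk : BT -> seq T) K K' (b0 : BT)
    (d : T) n (S : {set n.-tuple T}) :
  (forall b, K <= size (blk b)) -> (forall b, size (blk b) <= K') -> 0 < K ->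
  (forall t, t \in S -> exists bs, infix t (flatten (map blk bs))) ->
  #|S| <= K'.+1 * #|BT| ^ (n %/ K + 2).
Proof.
move=> hge hle K0 hS.
pose f (x : 'I_K'.+1 * (n %/ K + 2).-tuple BT) : n.-tuple T :=
  [tuple nth d (drop x.1 (flatten (map blk x.2))) k | k < n].
apply: (@leq_trans #|f @: [set: 'I_K'.+1 * (n %/ K + 2).-tuple BT]|); last first.
  by apply: leq_trans (leq_imset_card _ _) _; rewrite cardsT card_prod card_ord card_tuple.
apply: subset_leq_card; apply/subsetP => t /hS[bs /infixP[p [s E]]].
have hs : size p + n <= size (flatten (map blk bs)).
  by rewrite E !size_cat size_tuple leq_add2l leq_addr.
have [i [w [hi Et]]] := factor_flatten b0 hge hle K0 hs.
have {}Et : tval t = take n (drop i (flatten (map blk w))).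
  by rewrite -Et E drop_size_cat // take_size_cat ?size_tuple.
apply/imsetP; exists (inord i, w) => //.
apply/val_inj/(@eq_from_nth _ d); first by rewrite !size_tuple.
move=> k; rewrite size_tuple => hk.
rewrite -[k]/(val (Ordinal hk)) -!tnth_nth tnth_mktuple /= (tnth_nth d) Et /=.
by rewrite nth_take // inordK.
Qed.

(** Equal lengths align the blocks of the two concatenations. *)
Lemma flatten_inj (T U : eqType) (f : U -> seq T) (n : nat) (us vs : seq U) :
  {in us & vs, injective f} -> (forall u, u \in us ++ vs -> size (f u) = n) ->
  size us = size vs -> flatten (map f us) = flatten (map f vs) -> us = vs.
Proof.
elim: us vs => [|u us IH] [|v vs] // hf hs /= [sz] /eqP.
have hu : size (f u) = n by apply: hs; rewrite mem_cat mem_head.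
have hv : size (f v) = n by apply: hs; rewrite mem_cat mem_head orbT.
rewrite eqseq_cat ?hu ?hv //.
case/andP=> /eqP/hf -> ; rewrite ?mem_head // => /eqP/IH -> //.
  by move=> a b ha hb; apply: hf; rewrite inE ?ha ?hb orbT.
by move=> a ha; apply: hs; move: ha; rewrite !(mem_cat, inE) => /orP[]->; rewrite ?orbT.
Qed.

(** * Bi-infinite sequences and their periods *)

Local Open Scope ring_scope.
Section Sequences.
Variable T : Type.
Implicit Types (x y : int -> T) (d n : nat).

Definition shiftZ x : int -> T := fun i => x (i + 1).
Definition window x (j : int) n : seq T := mkseq (fun k : nat => x (j + k%:Z)) n.
Definition period d x := forall i, x (i + d%:Z) = x i.
Definition exact_period x n :=
  [/\ (0 < n)%N, period n x & forall m, (0 < m < n)%N -> ~ period m x].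

Lemma iter_sh n x i : iter n shiftZ x i = x (i + n%:Z).
Proof.
elim: n i => [|n IH] i /=; first by rewrite addr0.
by rewrite /shiftZ IH; congr x; lia.
Qed.

Lemma iter_sh_period n x : iter n shiftZ x = x <-> period n x.
Proof.
split=> [h i|h]; first by rewrite -iter_sh h.
by apply/funext => i; rewrite iter_sh h.
Qed.

Lemma period_mulz d x : period d x -> forall (q : int) i, x (i + q * d%:Z) = x i.
Proof.
move=> h q i.
have hn (n : nat) j : x (j + n%:Z * d%:Z) = x j.
  elim: n => [|n IH]; first by congr x; lia.
  by rewrite -[RHS]IH -[RHS]h; congr x; lia.
case: (lerP 0 q) => hq; first by rewrite -(hn `|q|%N i); congr x; lia.
by rewrite -[LHS](hn `|q|%N); congr x; lia.
Qed.

Lemma period_modn d x : period d x -> forall (j : int) (i : nat),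
  x (j + i%:Z) = x (j + (i %% d)%N%:Z).
Proof.
move=> h j i; rewrite {1}(divn_eq i d) -[RHS](period_mulz h (i %/ d)%N%:Z).
by congr x; lia.
Qed.

Lemma period_muln d d' x : period d x -> period (d * d') x.
Proof. by move=> h i; rewrite PoszM mulrC period_mulz. Qed.

Lemma period_shift d x (j : int) : period d x -> period d (fun i => x (i + j)).
Proof. by move=> h i; rewrite -(h (i + j)); congr x; lia. Qed.

Lemma period_eq_common d x y (a : int) : (0 < d)%N -> period d x -> period d y ->
  (forall k : nat, (k < d)%N -> x (a + k%:Z) = y (a + k%:Z)) -> x = y.
Proof.
move=> d0 hx hy h; apply/funext => i.
have hD : d%:Z != 0 by lia.
pose r := `|((i - a) %% d%:Z)%Z|%N.
have hr : (r%:Z = (i - a) %% d%:Z)%Z by rewrite /r gez0_abs // modz_ge0.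
have hr' : (r < d)%N by have := ltz_pmod (i - a) (_ : 0 < d%:Z); lia.
have E : i = a + r%:Z + ((i - a) %/ d%:Z)%Z * d%:Z.
  by have := divz_eq (i - a) d%:Z; rewrite -hr; lia.
by rewrite E !period_mulz // h.
Qed.

(** The product of the two periods is a common period, so agreement on one
    such stretch is agreement everywhere. *)
Lemma period_eq d d' x y (a : int) : (0 < d)%N -> (0 < d')%N ->
  period d x -> period d' y ->
  (forall k : nat, (k < d * d')%N -> x (a + k%:Z) = y (a + k%:Z)) -> x = y.
Proof.
move=> d0 d'0 hx hy; apply: period_eq_common; first by rewrite muln_gt0 d0.
  exact: period_muln.
by rewrite mulnC; exact: period_muln.
Qed.

Lemma exact_period_dvdn x n m : exact_period x n -> period m x -> (n %| m)%N.
Proof.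
move=> [n0 hn hl] hm; rewrite /dvdn; apply: contraT; rewrite -lt0n => h.
exfalso; apply: (hl (m %% n)%N); first by rewrite h ltn_mod.
move=> i; rewrite -(hm i) -[LHS](period_mulz hn (m %/ n)%N%:Z).
by congr x; rewrite [in RHS](divn_eq m n) PoszD PoszM; ring.
Qed.

Lemma exact_period_uniq x n m : exact_period x n -> exact_period x m -> n = m.
Proof.
move=> hn hm; have [_ pn _] := hn; have [_ pm _] := hm.
by apply/eqP; rewrite eqn_dvd (exact_period_dvdn hn pm) (exact_period_dvdn hm pn).
Qed.

Lemma period_exact_period x d : (0 < d)%N -> period d x ->
  exists n, [/\ exact_period x n, (n <= d)%N & (n %| d)%N].
Proof.
move=> d0 h.
have ex : exists n, (0 < n)%N && `[< period n x >].
  by exists d; rewrite d0; apply/asboolP.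
case: (ex_minnP ex) => n /andP[n0 /asboolP hn] hmin.
have hl : exact_period x n.
  split=> // m /andP[m0 mn] hm.
  have : (n <= m)%N by apply: hmin; rewrite m0; apply/asboolP.
  by rewrite leqNgt mn.
exists n; split => //; last exact: exact_period_dvdn hl h.
by apply: hmin; rewrite d0; apply/asboolP.
Qed.

Lemma exact_period_sh x n : exact_period x n -> exact_period (shiftZ x) n.
Proof.
move=> [n0 hn hl]; split=> // [|m hm h]; first exact: period_shift hn.
apply: (hl m) => // i; have := h (i - 1); rewrite /shiftZ.
by rewrite subrK (_ : i - 1 + m%:Z + 1 = i + m%:Z) //; lia.
Qed.

Lemma size_window x j n : size (window x j n) = n.
Proof. by rewrite size_mkseq. Qed.

Lemma nth_window t0 x j n k : (k < n)%N -> nth t0 (window x j n) k = x (j + k%:Z).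
Proof. exact: nth_mkseq. Qed.

Lemma eq_window x y j j' n :
  (forall k : nat, (k < n)%N -> x (j + k%:Z) = y (j' + k%:Z)) ->
  window x j n = window y j' n.
Proof.
move=> h; apply: (@eq_from_nth _ (x 0)); rewrite ?size_window // => k hk.
by rewrite !nth_window // h.
Qed.

Lemma window_eq x y j j' n : window x j n = window y j' n ->
  forall k : nat, (k < n)%N -> x (j + k%:Z) = y (j' + k%:Z).
Proof. by move=> h k hk; rewrite -!(nth_window (x 0) _ _ hk) h. Qed.

Lemma window_cat x j m n : window x j (m + n) = window x j m ++ window x (j + m%:Z) n.
Proof.
rewrite /window /mkseq iotaD map_cat; congr cat.
rewrite add0n -{1}[m]addn0 iotaDl -map_comp; apply: eq_map => k /=.
by congr x; lia.
Qed.

End Sequences.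

Lemma window_map (T U : Type) (f : T -> U) x j n :
  window (fun i => f (x i)) j n = map f (window x j n).
Proof. by rewrite /window /mkseq -map_comp. Qed.

Lemma period_map (T U : Type) (f : T -> U) x d :
  period d x -> period d (fun i => f (x i)).
Proof. by move=> h i; rewrite h. Qed.

Lemma window_take_drop (T : eqType) (t0 : T) (x : int -> T) (s : seq T) (a j : int) n :
  (forall i : nat, (i < size s)%N -> x (a + i%:Z) = nth t0 s i) ->
  a <= j -> j + n%:Z <= a + (size s)%:Z ->
  window x j n = take n (drop `|j - a|%N s).
Proof.
move=> h h1 h2; apply: (@eq_from_nth _ t0).
  by rewrite size_window size_take size_drop; case: ltnP; lia.
move=> k; rewrite size_window => hk; rewrite nth_window // nth_take // nth_drop -h; last by lia.
by congr x; lia.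
Qed.

Lemma infix_take_drop (T : eqType) (s : seq T) i n : infix (take n (drop i s)) s.
Proof. exact: infix_trans (infix_take _ _) (infix_drop _ _). Qed.

(** * Label words of a connected graph *)

Local Close Scope ring_scope.
Section Graph.
Variables (V B : finType) (e : rel V) (lam : V -> B).
Variables (G : nat) (conn : V -> V -> seq V) (alpha : V).
Hypothesis G_gt0 : 0 < G.
Hypothesis conn_walk : forall s t, walk e s (conn s t) t.
Hypothesis size_conn : forall s t, size (conn s t) = G.

Definition detour (s : V) (p : seq V) : seq V :=
  conn alpha s ++ belast s p ++ conn (last s p) alpha.

Lemma size_detour s p : size (detour s p) = G + (size p + G).
Proof. by rewrite !size_cat size_belast !size_conn. Qed.

Lemma detour_walk s p : path e s p -> walk e alpha (detour s p) alpha.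
Proof.
move=> h; apply: walk_cat (conn_walk _ _) _.
exact: walk_cat (walk_path h) (conn_walk _ _).
Qed.

Lemma conn_cons s t : exists l, conn s t = s :: l.
Proof.
have := conn_walk s t; have := size_conn s t.
case: (conn s t) => [|x l] /=; first by move: G_gt0; case: G.
by move=> _ /andP[/eqP-> _]; exists l.
Qed.

Lemma detour_word s p r :
  take (size p).+1 (drop G (detour s p ++ r)) = s :: p.
Proof.
have [l El] := conn_cons (last s p) alpha.
rewrite /detour El -!catA drop_size_cat ?size_conn // cat_cons -cat_rcons -lastI.
exact: take_size_cat.
Qed.

(** A word of length n is read along a path with n - 1 edges; this is meant for
    n > 0. *)
Definition labels n : {set n.-tuple B} :=
  [set t : n.-tuple B | [exists s, exists p : n.-1.-tuple V,
     path e s p && (map lam (s :: p) == tval t)]].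

Lemma labelsP n (t : n.-tuple B) : 0 < n ->
  reflect (exists s p, [/\ path e s p, size p = n.-1 & map lam (s :: p) = t])
          (t \in labels n).
Proof.
move=> n0; rewrite inE; apply: (iffP idP).
  move=> /existsP[s /existsP[p /andP[h /eqP E]]].
  by exists s, p; rewrite size_tuple.
move=> [s [p [h sp E]]]; apply/existsP; exists s; apply/existsP.
have sp' : size p == n.-1 by apply/eqP.
by exists (Tuple sp'); rewrite /= h; apply/eqP.
Qed.

(** The value on a word that is not in [labels k] is a dummy. *)
Definition block k (t : k.-tuple B) : seq V :=
  if [pick sp : V * k.-1.-tuple V |
        path e sp.1 sp.2 && (map lam (sp.1 :: sp.2) == tval t)] is Some sp
  then detour sp.1 sp.2 else [::].

(** The copy of t sits at offset G, so a block can be told from its labels. *)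
Lemma blockP k (t : k.-tuple B) : 0 < k -> t \in labels k ->
  [/\ walk e alpha (block t) alpha, size (block t) = G + G + k.-1 &
      take k (drop G (map lam (block t))) = t].
Proof.
move=> k0 /(labelsP _ k0)[s [p [h sp E]]].
rewrite /block; case: pickP => [[s' p'] /= /andP[h' /eqP E']|]; last first.
  have sp' : size p == k.-1 by apply/eqP.
  by move=> /(_ (s, Tuple sp')) /=; rewrite h -E /= eqxx.
split; [exact: detour_walk | by rewrite size_detour size_tuple; lia |].
have := detour_word s' p' [::]; rewrite cats0 size_tuple prednK // => Ed.
by rewrite -map_drop -map_take Ed.
Qed.

Lemma card_labels_mul k m : 0 < k -> 0 < m ->
  #|labels k| ^ m <= #|labels (m * (G + G + k.-1))|.
Proof.
move=> k0 m0; set K := G + G + k.-1.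
have K0 : 0 < K by rewrite /K; lia.
pose U := {t : k.-tuple B | t \in labels k}.
have -> : #|labels k| = #|{: U}| by rewrite card_sig.
rewrite -card_tuple.
pose wd (t : U) := block (val t).
have hw (t : U) := blockP k0 (valP t).
pose W (w : m.-tuple U) := flatten (map wd w).
have sW (w : m.-tuple U) : size (W w) = m * K.
  rewrite /W size_flatten /shape -map_comp (eq_map (_ : _ =1 fun=> K)); last first.
    by move=> t /=; have [_ -> _] := hw t.
  by rewrite sumnE big_map big_const_seq count_predT size_tuple iter_addn_0 mulnC.
have wW (w : m.-tuple U) : walk e alpha (W w) alpha.
  by apply: walk_flatten => l /mapP[t _ ->]; have [] := hw t.
have sf w : size (map lam (W w)) == m * K by rewrite size_map sW.
pose f w : (m * K).-tuple B := Tuple (sf w).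
have finj : injective f.
  move=> w w' /(congr1 val) /=; rewrite /W !map_flatten -!map_comp => h.
  apply/val_inj/(flatten_inj (n := K) _ _ _ h); rewrite ?size_tuple //.
  - move=> t t' _ _ /= /(congr1 (fun s => take k (drop G s))).
    by have [_ _ ->] := hw t; have [_ _ ->] := hw t' => h'; apply/val_inj/val_inj.
  - by move=> t _ /=; rewrite size_map; have [_ -> _] := hw t.
rewrite -cardsT -(card_imset _ finj); apply: subset_leq_card.
apply/subsetP => _ /imsetP[w _ ->]; apply/labelsP; first by rewrite muln_gt0 m0.
have := wW w; rewrite /f /=; have := sW w; case: (W w) => [|x l] /= hs.
  by move: hs => /esym/eqP; rewrite muln_eq0; lia.
move=> /andP[_]; rewrite rcons_path => /andP[h _].
by exists x, l; split => //; lia.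
Qed.

(** Factors of label words of blocks number about #|BT| ^ (n / K), and the words
    of period less than n0 are boundedly many; both are outnumbered by the label
    words of length n = m * K, of which there are at least #|labels k| ^ m. *)
Lemma rare_word (BT : finType) (blk : BT -> seq V) k K K' n0 :
  0 < k -> K = G + G + k.-1 ->
  (forall b, K <= size (blk b)) -> (forall b, size (blk b) <= K') ->
  0 < #|BT| -> #|BT| < #|labels k| ->
  exists n (u : n.-tuple B), [/\ 0 < n, u \in labels n,
    forall bs, ~~ infix u (map lam (flatten (map blk bs))) &
    forall (y : int -> B) d j, 0 < d < n0 -> period d y -> window y j n <> u].
Proof.
move=> k0 EK hge hle BT0 hBT.
have K0 : 0 < K by lia.
have /card_gt0P[b0 _] := BT0.
set Q := #|BT| in BT0 hBT.
have [m0 hm0] := poly_mul_exp_le (K'.+2 + n0 * #|B| ^ n0) 2 BT0.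
pose m := m0.+1; pose n := m * K.
have n_gt0 : 0 < n by rewrite /n muln_gt0.
apply: contrapT => hno.
(* If there is no such u, then S1, the factors of block words, and S2, the words
   of period less than n0, cover all label words. *)
pose S1 : {set n.-tuple B} :=
  [set t : n.-tuple B | `[< exists bs, infix (tval t) (map lam (flatten (map blk bs))) >]].
pose d0 := lam alpha.
pose g (x : 'I_n0 * n0.-tuple B) : n.-tuple B :=
  [tuple nth d0 x.2 (i %% x.1) | i < n].
pose S2 := g @: [set: 'I_n0 * n0.-tuple B].
have hsub : labels n \subset S1 :|: S2.
  apply/subsetP => t ht; rewrite in_setU; apply: contrapT => /negP.
  rewrite negb_or => /andP[h1 h2]; apply: hno; exists n, t; split=> //.
    by move=> bs; apply/negP => hi; move: h1; rewrite inE => /asboolP; apply; exists bs.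
  move=> y d j /andP[dp dn] hy E; move: h2 => /negP; apply.
  have sw : size (window y j n0) == n0 by rewrite size_window.
  apply/imsetP; exists (Ordinal dn, Tuple sw) => //.
  apply/val_inj/(@eq_from_nth _ d0); rewrite !size_tuple // => i hi.
  have -> : nth d0 (val (g (Ordinal dn, Tuple sw))) i = nth d0 (window y j n0) (i %% d).
    have := tnth_mktuple (fun i : 'I_n => nth d0 (window y j n0) (i %% d)) (Ordinal hi).
    by rewrite (tnth_nth d0).
  have -> : val t = window y j n by rewrite E.
  rewrite nth_window // nth_window; last by apply: leq_trans (ltn_pmod _ _) _; lia.
  exact: period_modn.
have c1 : #|S1| <= K'.+1 * Q ^ (m + 2).
  have := @card_factors_flatten B BT (fun b => map lam (blk b)) K K' b0 d0 n S1.
  rewrite /n mulnK //; apply=> //; try by move=> b; rewrite size_map.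
  move=> t; rewrite inE => /asboolP[bs h]; exists bs.
  by move: h; rewrite map_flatten -map_comp.
have c2 : #|S2| <= n0 * #|B| ^ n0.
  by apply: leq_trans (leq_imset_card _ _) _; rewrite cardsT card_prod card_ord card_tuple.
have c3 : Q.+1 ^ m <= #|labels n|.
  by rewrite /n EK; apply: leq_trans (card_labels_mul k0 _) => //; rewrite leq_exp2r.
have c4 := leq_trans (subset_leq_card hsub) (leq_card_setU _ _).
have c5 := hm0 m (leqnSn _).
have c6 : Q.+1 ^ (m - 2) <= Q.+1 ^ m by rewrite leq_exp2l // leq_subr.
have c7 : 0 < Q ^ (m + 2) by rewrite expn_gt0 BT0.
set X := Q ^ _ in c1 c5 c7; move: c1 c2 c3 c4 c5 c6 c7.
set Y := n0 * _; set P := Q.+1 ^ m; set P' := Q.+1 ^ _ => c1 c2 c3 c4 c5 c6 c7.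
have c8 : (K'.+2 + Y) * X <= (K'.+2 + Y) * m.+1 * X.
  by rewrite leq_mul2r leq_pmulr ?orbT.
have c9 : Y <= Y * X by rewrite leq_pmulr.
have : (K'.+2 + Y) * X <= K'.+1 * X + Y * X.
  apply: leq_trans (leq_trans c8 (leq_trans c5 (leq_trans c6 (leq_trans c3 c4)))) _.
  exact: leq_add c1 (leq_trans c2 c9).
by rewrite mulnDl mulSn -addnA -{2}[_ + Y * X]add0n leq_add2r leqNgt c7.
Qed.

End Graph.

(** * Equivariant lifts between cyclic actions *)

Lemma card_leq_inj (T1 T2 : finType) (P1 : {pred T1}) (P2 : {pred T2}) (d2 : T2) :
  #|P1| <= #|P2| ->
  exists h : T1 -> T2, {in P1, forall x, h x \in P2} /\ {in P1 &, injective h}.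
Proof.
rewrite !cardE => h.
have hx x : x \in P1 -> index x (enum P1) < size (enum P2).
  by move=> hx; apply: leq_trans h; rewrite index_mem mem_enum.
exists (fun x => nth d2 (enum P2) (index x (enum P1))); split.
  by move=> x /hx hi; rewrite -mem_enum mem_nth.
move=> x y hx1 hy1 /eqP; rewrite nth_uniq ?enum_uniq ?hx // => /eqP h'.
have := nth_index x (_ : x \in enum P1); rewrite mem_enum => /(_ hx1) <-.
by rewrite h' nth_index // mem_enum.
Qed.

(** A comparison of cardinals between free actions of a cyclic group compares
    the numbers of orbits, and the choices made on one point of each orbit
    extend to the orbit. *)
Lemma equivariant_lift (T1 T2 T3 : finType) (f1 : T1 -> T1) (f2 : T2 -> T2)
    (f3 : T3 -> T3) (lam : T3 -> T2) n (a1 : {pred T1}) (a2 : {pred T2})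
    (D : pred T3) (d3 : T3) :
  0 < n -> injective f1 -> injective f2 ->
  fclosed f1 a1 -> a1 \subset order_set f1 n ->
  fclosed f2 a2 -> a2 \subset order_set f2 n ->
  (forall x, lam (f3 x) = f2 (lam x)) -> (forall x, D x -> D (f3 x)) ->
  (forall y, y \in a2 -> exists x, [/\ D x, iter n f3 x = x & lam x = y]) ->
  #|a1| <= #|a2| ->
  exists h : T1 -> T3, {in a1, forall t, [/\ D (h t), iter n f3 (h t) = h t,
     h (f1 t) = f3 (h t) & lam (h t) \in a2]} /\
    {in a1 &, injective (lam \o h)}.
Proof.
move=> n0 inj1 inj2 cl1 o1 cl2 o2 hlam hD hlift hc.
have s1 := fconnect_sym inj1; have s2 := fconnect_sym inj2.
have fr1 x i : froot f1 (iter i f1 x) = froot f1 x.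
  by apply/eqP; rewrite (root_connect s1) s1 fconnect_iter.
have fr2 x i : froot f2 (iter i f2 x) = froot f2 x.
  by apply/eqP; rewrite (root_connect s2) s2 fconnect_iter.
have : fcard f1 a1 <= fcard f2 a2.
  by move: hc; rewrite -(fcard_order_set inj1 o1 cl1) -(fcard_order_set inj2 o2 cl2) leq_pmul2r.
case/(card_leq_inj (lam d3)) => h0 [h0P h0inj].
have hl y : exists x, y \in a2 -> [/\ D x, iter n f3 x = x & lam x = y].
  case: (boolP (y \in a2)) => [/hlift[x hx]|_]; first by exists x.
  by exists d3.
have [l hlP] := choice hl.
have hit y i : lam (iter i f3 y) = iter i f2 (lam y).
  by elim: i => //= i <-; rewrite hlam.
pose r t := froot f1 t.
have rP t : t \in a1 -> r t \in predI (froots f1) a1.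
  move=> ht; apply/andP; split; first exact: roots_root.
  suff : r t \in a1 by [].
  by rewrite -(closed_connect cl1 (connect_root _ t)).
have or1 t : t \in a1 -> order f1 (r t) = n.
  by move=> /rP /andP[_ /(subsetP o1)]; rewrite inE => /eqP.
have fr t : fconnect f1 (r t) t by rewrite s1 connect_root.
pose k t := findex f1 (r t) t.
have kP t : iter (k t) f1 (r t) = t by apply: iter_findex; apply: fr.
have kn t : t \in a1 -> k t < n by move=> ht; rewrite -(or1 t ht) findex_max.
have h0a t : t \in a1 -> h0 (r t) \in a2.
  by move=> /rP /h0P /andP[].
have h0r t : t \in a1 -> h0 (r t) \in froots f2.
  by move=> /rP /h0P /andP[].
have ord2 t : t \in a1 -> order f2 (h0 (r t)) = n.
  by move=> /h0a /(subsetP o2); rewrite inE => /eqP.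
have lP t : t \in a1 -> [/\ D (l (h0 (r t))), iter n f3 (l (h0 (r t))) = l (h0 (r t))
   & lam (l (h0 (r t))) = h0 (r t)] by move=> ht; apply: hlP; exact: h0a.
exists (fun t => iter (k t) f3 (l (h0 (r t)))); split.
  move=> t ht; have [D1 I1 L1] := lP t ht; split.
  - by elim: (k t) => //= i; apply: hD.
  - by rewrite -iterD addnC iterD I1.
  - have rf : r (f1 t) = r t := fr1 t 1.
    rewrite rf -iterS; set x := l _ in I1 *.
    have hft : f1 t \in a1 by rewrite -(cl1 t (f1 t)) ?eqxx //=.
    have E : iter (k (f1 t)) f1 (r t) = iter (k t).+1 f1 (r t).
      by rewrite iterS kP -rf kP.
    have hk1 := kn _ hft; have hk := kn _ ht.
    case: (ltnP (k t).+1 n) => hkn.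
      congr (iter _ f3 x).
      have := findex_iter (f := f1) (x := r t) (i := k (f1 t)); rewrite or1 // E => /(_ hk1) <-.
      by rewrite findex_iter // or1.
    have Ek : (k t).+1 = n by lia.
    rewrite Ek I1; rewrite Ek -(or1 t ht) (iter_order inj1) in E.
    have -> // : k (f1 t) = 0.
    have := findex_iter (f := f1) (x := r t) (i := k (f1 t)); rewrite or1 // E => /(_ hk1) <-.
    by rewrite findex0.
  - rewrite hit L1; elim: (k t) => /= [|i IH]; first exact: h0a.
    by rewrite -(cl2 (iter i f2 (h0 (r t)))) //=.
move=> t u ht hu /=; rewrite !hit.
have [_ _ ->] := lP t ht; have [_ _ ->] := lP u hu => E.
have Er : h0 (r t) = h0 (r u).
  have e1 : froot f2 (iter (k t) f2 (h0 (r t))) = h0 (r t).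
    by rewrite fr2; apply/eqP/h0r.
  have e2 : froot f2 (iter (k u) f2 (h0 (r u))) = h0 (r u).
    by rewrite fr2; apply/eqP/h0r.
  by rewrite -e1 E e2.
have Err : r t = r u by apply: h0inj Er; exact: rP.
have Ek : k t = k u.
  rewrite -(findex_iter (f := f2) (x := h0 (r t)) (i := k t)) ?ord2 ?kn //.
  by rewrite E Er findex_iter // ord2 // kn.
by rewrite -(kP t) -(kP u) Ek Err.
Qed.

Local Open Scope ring_scope.
Section Cycles.
Variables (T : finType) (n : nat).

(** Sequences of period n + 1 are identified with tuples, on which the shift is
    a permutation; orders of that permutation are least periods. *)
Definition unroll (t : n.+1.-tuple T) : int -> T :=
  fun i => tnth t (inord `|(i %% n.+1%:Z)%Z|).
Definition wrap (x : int -> T) : n.+1.-tuple T := [tuple x i%:Z | i < n.+1].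

Lemma unroll_period t : period n.+1 (unroll t).
Proof. by move=> i; rewrite /unroll modzDr. Qed.

Lemma wrapK x : period n.+1 x -> unroll (wrap x) = x.
Proof.
move=> h; apply/funext => i; rewrite /unroll tnth_mktuple.
have h1 := modz_ge0 i (_ : n.+1%:Z != 0); have h2 := ltz_pmod i (_ : 0 < n.+1%:Z).
rewrite inordK; last by have := h1 isT; have := h2 isT; lia.
by rewrite gez0_abs ?h1 // {2}(divz_eq i n.+1%:Z) addrC period_mulz.
Qed.

Lemma unrollK t : wrap (unroll t) = t.
Proof.
apply/eq_from_tnth => i; rewrite tnth_mktuple /unroll modz_small ?ltz_nat //=.
by rewrite inord_val.
Qed.

Definition wsh t := wrap (shiftZ (unroll t)).

Lemma unroll_wsh t : unroll (wsh t) = shiftZ (unroll t).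
Proof. by rewrite wrapK //; apply: period_shift; exact: unroll_period. Qed.

Lemma unroll_iter t i : unroll (iter i wsh t) = iter i (@shiftZ T) (unroll t).
Proof. by elim: i => //= i <-; rewrite unroll_wsh. Qed.

Lemma unroll_inj : injective unroll.
Proof. exact: can_inj unrollK. Qed.

Lemma wsh_inj : injective wsh.
Proof.
move=> t u /(congr1 unroll); rewrite !unroll_wsh => h; apply: unroll_inj.
apply/funext => i; have := congr1 (fun f => f (i - 1)) h.
by rewrite /shiftZ subrK.
Qed.

Lemma iter_wsh t : iter n.+1 wsh t = t.
Proof.
by apply: unroll_inj; rewrite unroll_iter; apply/iter_sh_period/unroll_period.
Qed.

Lemma order_wsh t : exact_period (unroll t) n.+1 -> order wsh t = n.+1.
Proof.
move=> hl; apply/eqP; rewrite eqn_leq; apply/andP; split.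
  rewrite leqNgt; apply/negP => /findex_iter.
  by rewrite iter_wsh findex0.
apply: dvdn_leq; first exact: order_gt0.
apply: exact_period_dvdn hl _; apply/iter_sh_period.
by rewrite -unroll_iter iter_order //; exact: wsh_inj.
Qed.

End Cycles.

Section Lift.
Variables (C V B : finType) (lam : V -> B) (v0 : V) (n : nat).
Variables (S : (int -> C) -> Prop) (D : (int -> V) -> Prop).
Variable (g : (int -> C) -> (int -> B)).
Hypothesis S_sh : forall z, S z -> S (shiftZ z).
Hypothesis S_exact_period : forall z, S z -> exact_period z n.
Hypothesis D_sh : forall x, D x -> D (shiftZ x).
Hypothesis gP : forall z, S z -> exact_period (g z) n /\
  exists x, [/\ D x, period n x & lam \o x = g z].
Hypothesis g_inj : forall z z', S z -> S z' -> g z = g z' -> z = z'.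

(** The hypothesis that there are enough points below is the injection g, which
    need not commute with the shift.  Cycles are tuples under rotation, where
    only the numbers of orbits matter. *)
Lemma lift_periodic : exists h : (int -> C) -> (int -> V),
  (forall z, S z -> [/\ D (h z), h (shiftZ z) = shiftZ (h z) & exact_period (lam \o h z) n]) /\
  (forall z z', S z -> S z' -> lam \o h z = lam \o h z' -> z = z').
Proof.
have [n0|n0] := posnP n.
  have no z : ~ S z by move=> hz; have [] := S_exact_period hz; rewrite n0.
  by exists (fun _ _ => v0); split=> [z|z z'] /no.
case: n n0 S_exact_period gP => // m _ Sl gl.
pose a1 : {pred m.+1.-tuple C} := [pred t | `[< S (unroll t) >]].
pose a2 : {pred m.+1.-tuple B} := [pred y | `[< exact_period (unroll y) m.+1 /\
  exists x, [/\ D x, period m.+1 x & lam \o x = unroll y] >]].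
pose D' : pred (m.+1.-tuple V) := [pred x | `[< D (unroll x) >]].
pose lam' (t : m.+1.-tuple V) : m.+1.-tuple B := [tuple of map lam t].
have lamE t : unroll (lam' t) = lam \o unroll t.
  by apply/funext => i; rewrite /unroll /lam' tnth_map.
have lam_sh x : lam \o shiftZ x = shiftZ (lam \o x) by [].
have hlam x : lam' (wsh x) = wsh (lam' x).
  by apply: unroll_inj; rewrite lamE !unroll_wsh lamE lam_sh.
have cl1 : fclosed (@wsh C m) a1.
  apply: intro_closed; first exact/fconnect_sym/wsh_inj.
  move=> t _ /eqP <-; rewrite !inE => /asboolP h; apply/asboolP.
  by rewrite unroll_wsh; exact: S_sh.
have o1 : a1 \subset order_set (@wsh C m) m.+1.
  apply/subsetP => t; rewrite !inE => /asboolP/Sl h.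
  by apply/eqP/order_wsh.
have cl2 : fclosed (@wsh B m) a2.
  apply: intro_closed; first exact/fconnect_sym/wsh_inj.
  move=> t _ /eqP <-; rewrite !inE => /asboolP [h [x [h1 h2 h3]]]; apply/asboolP.
  rewrite unroll_wsh; split; first exact: exact_period_sh.
  exists (shiftZ x); split; [exact: D_sh | exact: period_shift | by rewrite -h3].
have o2 : a2 \subset order_set (@wsh B m) m.+1.
  apply/subsetP => t; rewrite !inE => /asboolP[h _].
  by apply/eqP/order_wsh.
have hD x : D' x -> D' (wsh x).
  by rewrite /D' /= => /asboolP h; apply/asboolP; rewrite unroll_wsh; exact: D_sh.
have hl y : y \in a2 -> exists x, [/\ D' x, iter m.+1 (@wsh V m) x = x & lam' x = y].
  rewrite inE => /asboolP[_ [x [h1 h2 h3]]]; exists (wrap m x); split.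
  - by apply/asboolP; rewrite wrapK.
  - exact: iter_wsh.
  - by apply: unroll_inj; rewrite lamE wrapK.
have hc : (#|a1| <= #|a2|)%N.
  pose f (t : m.+1.-tuple C) := wrap m (g (unroll t)).
  have fE t : t \in a1 -> unroll (f t) = g (unroll t).
    by rewrite inE => /asboolP/gl[[_ h _] _]; rewrite wrapK.
  rewrite -(@card_in_imset _ _ f a1).
    apply: subset_leq_card; apply/subsetP => _ /imsetP[t ht ->].
    have := ht; rewrite !inE => /asboolP/gl h; apply/asboolP.
    by rewrite fE.
  move=> t u ht hu /(congr1 (@unroll B m)); rewrite !fE // => E.
  apply: unroll_inj; apply: g_inj E; first by move: ht; rewrite inE => /asboolP.
  by move: hu; rewrite inE => /asboolP.
have [h [hP hinj]] := equivariant_lift (wrap m (fun=> v0)) (ltn0Sn m) (@wsh_inj C m)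
  (@wsh_inj B m) cl1 o1 cl2 o2 hlam hD hl hc.
have ha1 z : S z -> wrap m z \in a1.
  by move=> hz; have [_ hp _] := Sl _ hz; rewrite inE; apply/asboolP; rewrite wrapK.
exists (fun z => unroll (h (wrap m z))); split.
  move=> z hz; have := ha1 z hz => /hP[h1 h2 h3 h4].
  have [_ hp _] := Sl _ hz.
  split; first by move: h1 => /asboolP.
    by rewrite -unroll_wsh -h3 /wsh wrapK.
  by move: h4; rewrite inE lamE => /asboolP[].
move=> z z' hz hz' E.
have [_ hp _] := Sl _ hz; have [_ hp' _] := Sl _ hz'.
rewrite -(wrapK hp) -(wrapK hp'); congr unroll; apply: hinj; rewrite ?ha1 //=.
by apply: unroll_inj; rewrite !lamE.
Qed.

End Lift.

(** * Counting words of a shift-invariant set *)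

Section Words.
Variables (C : finType) (Z : (int -> C) -> Prop).

Definition words n : {set n.-tuple C} :=
  [set t : n.-tuple C | `[< exists z j, Z z /\ window z j n = t >]].

Lemma card_words_add m n : (#|words (m + n)| <= #|words m| * #|words n|)%N.
Proof.
pose f (t : (m + n).-tuple C) : m.-tuple C * n.-tuple C :=
  (tcast (minn_idPl (leq_addr n m)) [tuple of take m t],
   tcast (addKn m n) [tuple of drop m t]).
have finj : injective f.
  move=> t u [/(congr1 val) /= h1 /(congr1 val) /= h2]; apply: val_inj.
  by rewrite /= -[LHS](cat_take_drop m) -[RHS](cat_take_drop m); move: h1 h2; rewrite !val_tcast /= => -> ->.
rewrite -cardsX -(card_imset _ finj); apply: subset_leq_card.
apply/subsetP => _ /imsetP[t ht ->]; move: ht; rewrite in_setX !inE => /asboolP[z [j [hz E]]].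
move: E; rewrite window_cat => E.
apply/andP; split; apply/asboolP.
  by exists z, j; split=> //; rewrite val_tcast /= -E take_size_cat ?size_window.
by exists z, (j + m%:Z); split=> //; rewrite val_tcast /= -E drop_size_cat ?size_window.
Qed.

Lemma card_words_gt0 n : (exists z, Z z) -> (0 < #|words n|)%N.
Proof.
move=> [z hz]; have sw : size (window z 0 n) == n by rewrite size_window.
by apply/card_gt0P; exists (Tuple sw); rewrite inE; apply/asboolP; exists z, 0.
Qed.

Lemma card_words_leq m n : (m <= n)%N -> (#|words m| <= #|words n|)%N.
Proof.
move=> hmn.
pose f (t : n.-tuple C) : m.-tuple C := tcast (minn_idPl hmn) [tuple of take m t].
apply: leq_trans (leq_imset_card f _); apply: subset_leq_card.
apply/subsetP => t; rewrite inE => /asboolP[z [j [hz E]]].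
have sw : size (window z j n) == n by rewrite size_window.
apply/imsetP; exists (Tuple sw); first by rewrite inE; apply/asboolP; exists z, j.
apply: val_inj; rewrite /= val_tcast /= -E -(subnKC hmn) window_cat.
by rewrite take_size_cat ?size_window.
Qed.

Lemma card_words_exp K n : (0 < K)%N -> (#|words n| <= #|words K| ^ (n %/ K).+1)%N.
Proof.
move=> K0.
suff H m r : (r < K)%N -> (#|words (m * K + r)| <= #|words K| ^ m.+1)%N.
  by have := H (n %/ K)%N (n %% K)%N (ltn_pmod _ K0); rewrite -divn_eq.
move=> hr; elim: m => [|m IH]; first by rewrite mul0n add0n expn1 card_words_leq // ltnW.
by rewrite mulSn -addnA expnS; apply: leq_trans (card_words_add _ _) _; rewrite leq_mul2l IH orbT.
Qed.

End Words.

(** * Data words *)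

Local Close Scope ring_scope.
Section Cyc.
Variables (V : finType) (e : rel V) (v0 : V).

Definition repeated (l : seq V) : int -> V :=
  fun i => nth v0 l `|(i %% (Posz (size l)))%Z|.

Definition bipath (x : int -> V) := forall i : int, e (x i) (x (i + 1)%R).

Lemma repeated_period l : period (size l) (repeated l).
Proof. by move=> i; rewrite /repeated modzDr. Qed.

Lemma repeated_nth l (i : nat) : i < size l -> repeated l (Posz i) = nth v0 l i.
Proof. by move=> h; rewrite /repeated modz_small // ltz_nat h. Qed.

Lemma repeated_bipath s l : 0 < size l -> walk e s l s -> bipath (repeated l).
Proof.
move=> l0 hw i.
have D0 : ((Posz (size l)) != 0)%R by lia.
pose r := `|(i %% (Posz (size l)))%Z|.
have hr : ((Posz r) = (i %% (Posz (size l)))%Z)%R by rewrite /r gez0_abs // modz_ge0.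
have hr' : r < size l by have := ltz_pmod i (_ : (0 < (Posz (size l)))%R); lia.
have Ei : repeated l i = nth v0 l r by [].
have := walk_edge v0 hw hr'; rewrite Ei nth_rcons.
have E : ((i + 1) %% (Posz (size l)))%Z = Posz (r.+1 %% size l).
  by rewrite -modz_nat -modzDml -hr; congr modz; lia.
rewrite /repeated E; case: ltnP => h; first by rewrite modn_small.
have -> : r.+1 = size l by lia.
rewrite eqxx modnn absz0.
by have := walk_head v0 hw; rewrite nth_rcons l0 => ->.
Qed.

Lemma window_repeated l j n : 0 < size l ->
  window (repeated l) j n = take n (drop `|(j %% (Posz (size l)))%Z| (flatten (nseq n.+1 l))).
Proof.
move=> l0.
have D0 : ((Posz (size l)) != 0)%R by lia.
have h0 := modz_ge0 j D0; have h1 := ltz_pmod j (_ : (0 < (Posz (size l)))%R).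
have {}h1 := h1 ltac:(lia).
have sN r : size (flatten (nseq r l)) = r * size l.
  by elim: r => //= r IH; rewrite size_cat IH mulSn.
have hN r i : i < r * size l -> nth v0 (flatten (nseq r l)) i = nth v0 l (i %% size l).
  elim: r i => [|r IH] i; first by rewrite mul0n.
  rewrite mulSn /= nth_cat => hi; case: ltnP => h.
    by rewrite modn_small.
  by rewrite IH; [rewrite -[in RHS](subnK h) modnDr | lia].
set a := `|(j %% _)%Z|.
have ha : ((Posz a) = (j %% (Posz (size l)))%Z)%R by rewrite /a gez0_abs.
apply: (@eq_from_nth _ v0).
  by rewrite size_window size_take size_drop sN; case: ltnP => //; move: ha h1; nia.
move=> k; rewrite size_window => hk; rewrite nth_window // nth_take // nth_drop.
rewrite hN /repeated; last by move: ha h1; nia.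
by rewrite -modzDml -ha -PoszD modz_nat absz_nat.
Qed.

End Cyc.

Section Data.
Variables (V B : finType) (e : rel V) (lam : V -> B) (alpha : V) (K q : nat).
Variable (blk : option 'I_q -> seq V).
Hypothesis K_gt0 : 0 < K.
Hypothesis blk_walk : forall b, walk e alpha (blk b) alpha.
Hypothesis size_blk : forall i, size (blk (Some i)) = K.
Hypothesis size_blk0 : size (blk None) = K.+1.
Hypothesis blk_inj : injective (fun i => map lam (blk (Some i))).

(** A length L is K * (L %/ K - L %% K) + K.+1 * (L %% K), so a word of
    length L has room for [room L] free blocks once the remainder is filled. *)
Definition room L := L %/ K - L %% K.

Definition data_names L (fs : seq 'I_q) : seq (option 'I_q) :=
  nseq (L %% K) None ++ map Some fs.
Definition data L fs := flatten (map blk (data_names L fs)).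

Lemma blocks_walk bs : walk e alpha (flatten (map blk bs)) alpha.
Proof. by apply: walk_flatten => l /mapP[b _ ->]. Qed.

Lemma size_free_blocks (fs : seq 'I_q) :
  size (flatten (map blk (map Some fs))) = K * size fs.
Proof. by elim: fs => [|f fs IH] /=; rewrite ?muln0 // size_cat IH size_blk mulnS. Qed.

Lemma size_data L fs : size (data L fs) = (L %% K) * K.+1 + K * size fs.
Proof.
rewrite /data map_cat flatten_cat size_cat size_free_blocks; congr addn.
by elim: (_ %% _) => //= n IH; rewrite size_cat IH size_blk0 mulSn.
Qed.

Lemma size_data_room L fs : K * K <= L -> size fs = room L -> size (data L fs) = L.
Proof.
move=> hL hs; rewrite size_data hs /room.
have h1 : L %% K <= L %/ K.
  by apply: (@leq_trans K); [rewrite ltnW ?ltn_pmod | rewrite leq_divRL].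
rewrite [RHS](divn_eq L K) mulnBr; move: h1; set Q := _ %/ _; set r := _ %% _ => h1.
have : K * r <= K * Q by rewrite leq_mul2l h1 orbT.
rewrite mulnS; lia.
Qed.

Lemma data_walk L fs : walk e alpha (data L fs) alpha.
Proof. exact: blocks_walk. Qed.

Lemma free_blocks_inj (fs gs : seq 'I_q) : size fs = size gs ->
  map lam (flatten (map blk (map Some fs))) =
  map lam (flatten (map blk (map Some gs))) -> fs = gs.
Proof.
move=> hs; rewrite !map_flatten -!map_comp.
apply: (flatten_inj (n := K)) => //; first by move=> i j _ _; exact: blk_inj.
by move=> i _; rewrite /= size_map size_blk.
Qed.

Lemma data_inj L fs gs : size fs = size gs ->
  map lam (data L fs) = map lam (data L gs) -> fs = gs.
Proof.
move=> hs; rewrite /data !map_cat !flatten_cat !map_cat => /eqP.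
by rewrite eqseq_cat // => /andP[_ /eqP]; exact: free_blocks_inj.
Qed.

Definition good p (fs : seq 'I_q) := exact_period (lam \o repeated alpha (data p fs)) p.

Lemma lam_repeated_nth p fs i : i < size (data p fs) ->
  (lam \o repeated alpha (data p fs)) (Posz i) = nth (lam alpha) (map lam (data p fs)) i.
Proof. by move=> h; rewrite /= repeated_nth // (nth_map alpha). Qed.

Lemma data_repeated_inj p fs gs : 0 < p -> K * K <= p ->
  size fs = room p -> size gs = room p ->
  lam \o repeated alpha (data p fs) = lam \o repeated alpha (data p gs) -> fs = gs.
Proof.
move=> p0 hp hf hg E; apply: (@data_inj p); first by rewrite hf.
apply: (@eq_from_nth _ (lam alpha)); rewrite !size_map !size_data_room // => i hi.
by rewrite -!lam_repeated_nth ?size_data_room // E.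
Qed.

(** A sequence whose period d is a proper divisor of p is determined by its
    first half, hence by d and by the free blocks that cover this half. *)
Lemma card_bad p : 0 < p -> K * K <= p -> 0 < q ->
  #|[set fs : (room p).-tuple 'I_q | ~~ `[< good p fs >]]|
    <= p./2.+1 * q ^ (p./2 %/ K).+1.
Proof.
move=> p0 hp q0; set bad := finset _; set gam := (_ %/ K).+1.
pose y (fs : (room p).-tuple 'I_q) := lam \o repeated alpha (data p fs).
have sz (fs : (room p).-tuple 'I_q) : size (data p fs) = p.
  by rewrite size_data_room ?size_tuple.
have yp fs : period p (y fs).
  by rewrite -{1}(sz fs); apply: period_map; exact: repeated_period.
have hd (fs : (room p).-tuple 'I_q) : exists d : 'I_p./2.+1, fs \in bad ->
    (0 < d) /\ period d (y fs).
  case: (boolP (fs \in bad)) => [|_]; last by exists ord0.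
  rewrite inE => /asboolPn hb.
  have [d [hl hle hdv]] := period_exact_period p0 (yp fs).
  have d0 : 0 < d by case: hl.
  have dp : d < p./2.+1.
    have hlt : d < p.
      by rewrite ltn_neqAle hle andbT; apply/eqP => E; apply: hb; rewrite E in hl.
    by case/dvdnP: hdv => [[|[|c]] Ep]; nia.
  by exists (Ordinal dp) => _; split=> //; case: hl.
have [d hdP] := choice hd.
pose i0 : 'I_q := Ordinal q0.
pose f (fs : (room p).-tuple 'I_q) : 'I_p./2.+1 * gam.-tuple 'I_q :=
  (d fs, [tuple nth i0 fs i | i < gam]).
have finj : {in bad &, injective f}.
  move=> fs gs hfs hgs E; apply: val_inj.
  have Ed : d fs = d gs := congr1 fst E.
  have Et : [tuple nth i0 fs i | i < gam] = [tuple nth i0 gs i | i < gam] := congr1 snd E.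
  have Etake : take gam fs = take gam gs.
    apply: (@eq_from_nth _ i0); first by rewrite !size_take !size_tuple.
    move=> i; rewrite size_take size_tuple => hi.
    have hig : i < gam by move: hi; case: (ltnP gam (room p)); lia.
    rewrite !nth_take //.
    have := congr1 (fun t => tnth t (Ordinal hig)) Et.
    by rewrite !tnth_mktuple.
  case: (leqP (room p) gam) => hr.
    by move: Etake; rewrite !take_oversize ?size_tuple.
  have [d0 pd] := hdP _ hfs; have [_ pd'] := hdP _ hgs; rewrite -Ed in pd'.
  apply: (data_repeated_inj p0 hp); rewrite ?size_tuple //.
  apply: (period_eq_common (a := 0%R) d0 pd pd') => j hj.
  have hdp : d fs <= p./2 by have := ltn_ord (d fs); lia.
  rewrite add0r /y !lam_repeated_nth ?sz; try lia.
  have hcut hs : size hs = room p -> data p hs =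
     flatten (map blk (nseq (p %% K) None ++ map Some (take gam hs)))
       ++ flatten (map blk (map Some (drop gam hs))).
    by move=> _; rewrite -flatten_cat -map_cat -catA -map_cat cat_take_drop.
  rewrite !hcut ?size_tuple // Etake; set pre := flatten (map blk (_ ++ _)).
  rewrite !(map_cat _ pre) !nth_cat !size_map; have -> // : j < size pre.
  rewrite /pre map_cat flatten_cat size_cat size_free_blocks size_takel ?size_tuple; last by lia.
  have := ltn_ceil p./2 K_gt0; rewrite -/gam; lia.
rewrite -(card_in_imset finj); apply: leq_trans (max_card _) _.
by rewrite card_prod card_ord card_tuple card_ord.
Qed.

End Data.

(** * Coding the periodic points *)

Section Room.
Variables (C : finType) (Z : (int -> C) -> Prop) (K : nat).
Hypothesis K_gt0 : 0 < K.
Hypothesis Z_ex : exists z, Z z.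
Let q := #|words Z K|.+1.

(** With q one larger than the number of words of length K, the free blocks
    outnumber the words of length L even after d letters are set aside. *)
Lemma room_words c d : exists n1, forall L, n1 <= L ->
  c * #|words Z L| <= q ^ room K (L - d) /\ K * K + d <= L.
Proof.
have a0 : 0 < #|words Z K| := card_words_gt0 K Z_ex.
have [m0 hm] := poly_mul_exp_le c (d + K + 1) a0.
exists (m0 * K + K * K + d + K) => L hL; split; last by lia.
set m := L %/ K.
have hm0 : m0 <= m by rewrite leq_divRL //; lia.
apply: (@leq_trans (c * m.+1 * #|words Z K| ^ (m + (d + K + 1)))).
  rewrite -mulnA leq_mul2l; apply/orP; right.
  apply: leq_trans (card_words_exp Z L K_gt0) _; rewrite -/m.
  apply: (@leq_trans (#|words Z K| ^ (m + (d + K + 1)))); last by rewrite leq_pmull.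
  by rewrite leq_pexp2l //; lia.
apply: leq_trans (hm m hm0) _; rewrite leq_pexp2l // /room.
have h1 : (L - d) %% K < K by rewrite ltn_mod.
have h2 : m - d <= (L - d) %/ K.
  rewrite leq_divRL // mulnBl; have := leq_trunc_div L K; rewrite -/m => h.
  have : d <= d * K by rewrite leq_pmulr.
  lia.
lia.
Qed.

(** The bound of card_bad is at most half of all choices. *)
Lemma room_half : exists n1, forall p, n1 <= p ->
  2 * (p./2.+1 * q ^ (p./2 %/ K).+1) <= q ^ room K p.
Proof.
have [m0 hm] := poly_mul_exp_le (4 * K) (K + 1) (ltn0Sn 0).
exists ((m0.*2 + K + K + 4) * K) => p hp.
set m := p %/ K; pose h := m./2.
have hmm : m0.*2 + K + K + 4 <= m by rewrite leq_divRL.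
have hh : m0 <= h by rewrite /h; lia.
have a0 : 0 < #|words Z K| := card_words_gt0 K Z_ex.
have e1 : p./2 %/ K <= h.
  rewrite /h /m -!divn2 -!divnMA mulnC; exact: leqnn.
have e2 : p < m.+1 * K by exact: ltn_ceil.
have := hm h hh; rewrite exp1n muln1 => e3.
have e4 : m - K < room K p + 1.
  have : p %% K < K by rewrite ltn_mod.
  by rewrite /room -/m; lia.
apply: (@leq_trans (q ^ (h - (K + 1)) * q ^ h.+1)); last first.
  by rewrite -expnD leq_pexp2l //; rewrite /h in hh *; lia.
rewrite mulnA; apply: leq_mul; last by rewrite leq_pexp2l.
have q2 : 2 <= q by rewrite /q ltnS.
have hK : 0 < h - (K + 1) by rewrite /h; lia.
apply: (@leq_trans (2 ^ (h - (K + 1)))); last by rewrite leq_exp2r.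
apply: leq_trans e3.
have : m <= h.*2.+1 by rewrite /h; lia.
nia.
Qed.

End Room.

Section Theta.
Variables (V B C : finType) (e : rel V) (lam : V -> B) (alpha : V) (K : nat).
Variable (Z : (int -> C) -> Prop).
Let q := #|words Z K|.+1.
Variable (blk : option 'I_q -> seq V).
Hypothesis K_gt0 : 0 < K.
Hypothesis blk_walk : forall b, walk e alpha (blk b) alpha.
Hypothesis size_blk : forall i, size (blk (Some i)) = K.
Hypothesis size_blk0 : size (blk None) = K.+1.
Hypothesis blk_inj : injective (fun i => map lam (blk (Some i))).
Hypothesis Z_ex : exists z, Z z.
Hypothesis Z_sh : forall z, Z z -> Z (shiftZ z).
Hypothesis small : forall n, 0 < n -> exists g : (int -> C) -> (int -> B),
  (forall z, Z z -> exact_period z n -> exact_period (g z) n /\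
     exists x, [/\ bipath e x, period n x & lam \o x = g z]) /\
  (forall z z', Z z -> exact_period z n -> Z z' -> exact_period z' n -> g z = g z' -> z = z').

Definition in_blocks (y : int -> B) := forall j n,
  exists bs, infix (window y j n) (map lam (flatten (map blk bs))).

Lemma repeated_in_blocks bs : 0 < size (flatten (map blk bs)) ->
  in_blocks (lam \o repeated alpha (flatten (map blk bs))).
Proof.
set l := flatten _ => l0 j n; exists (flatten (nseq n.+1 bs)).
rewrite window_map window_repeated // map_take map_drop.
have -> : flatten (map blk (flatten (nseq n.+1 bs))) = flatten (nseq n.+1 l).
  by elim: n.+1 => //= r IH; rewrite map_cat flatten_cat IH.
exact: infix_take_drop.
Qed.

Lemma in_blocks_sh y : in_blocks y -> in_blocks (shiftZ y).
Proof.
move=> h j n; have [bs hb] := h (j + 1)%R n; exists bs.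
rewrite (_ : window (shiftZ y) j n = window y (j + 1)%R n) //.
by apply: eq_window => k _; rewrite /shiftZ; congr y; lia.
Qed.

(** At least half of the block words of length n repeat to a point of least
    period exactly n, and these are at least as many as the words of
    length n of Z. *)
Lemma large_periods : exists n0, forall n, n0 <= n ->
  exists g : (int -> C) -> (int -> B),
  (forall z, Z z -> exact_period z n -> exact_period (g z) n /\
     exists x, [/\ bipath e x, in_blocks (lam \o x), period n x & lam \o x = g z]) /\
  (forall z z', Z z -> exact_period z n -> Z z' -> exact_period z' n -> g z = g z' -> z = z').
Proof.
have [n1 h1] := room_words K_gt0 Z_ex 2 0.
have [n2 h2] := room_half K_gt0 Z_ex.
exists (n1 + n2 + 1) => p hp.
have p0 : 0 < p by lia.
have [{}h1 hKK] := h1 p ltac:(lia).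
have {}h2 := h2 p ltac:(lia).
rewrite addn0 in hKK; rewrite subn0 in h1.
pose gd : {set (room K p).-tuple 'I_q} :=
  [set fs : (room K p).-tuple 'I_q | `[< good lam alpha K blk p fs >]].
have hb := card_bad alpha K_gt0 size_blk size_blk0 blk_inj p0 hKK (ltn0Sn _).
have hc : #|words Z p| <= #|gd|.
  have hC : #|gd| + #|~: gd| = q ^ room K p by rewrite cardsC card_tuple card_ord.
  have eC : ~: gd = [set fs : (room K p).-tuple 'I_q | ~~ `[< good lam alpha K blk p fs >]].
    by apply/setP => fs; rewrite !inE.
  move: hC hb h1 h2; rewrite -eC -/q; move: #|~: gd| #|gd| #|words Z p| => x y w.
  by move: (q ^ room K p) (_ * q ^ _) => s t; lia.
have i0 : (room K p).-tuple 'I_q := [tuple of nseq _ ord0].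
have [h [hP hinj]] := card_leq_inj i0 hc.
have sw (z : int -> C) : size (window z 0%R p) == p by rewrite size_window.
pose W z : p.-tuple C := Tuple (sw z).
have hW z : Z z -> W z \in words Z p.
  by move=> hz; rewrite inE; apply/asboolP; exists z, 0%R.
have szd (fs : (room K p).-tuple 'I_q) : size (data K blk p fs) = p.
  by apply: size_data_room; rewrite ?size_tuple.
exists (fun z => lam \o repeated alpha (data K blk p (h (W z)))); split.
  move=> z hz hl; split.
    by have := hP _ (hW z hz); rewrite inE => /asboolP.
  exists (repeated alpha (data K blk p (h (W z)))); split=> //.
  - by apply: (@repeated_bipath _ _ _ alpha); rewrite ?szd //; exact: data_walk.
  - by apply: repeated_in_blocks; rewrite -/(data K blk p _) szd.
  - by rewrite -{1}(szd (h (W z))); exact: repeated_period.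
move=> z z' hz hl hz' hl' E.
have E1 : h (W z) = h (W z').
  by apply: val_inj; apply: (data_repeated_inj _ _ _ _ p0 hKK _ _ E); rewrite ?size_tuple.
have /(congr1 val) /= E2 := hinj _ _ (hW z hz) (hW z' hz') E1.
have [_ pz _] := hl; have [_ pz' _] := hl'.
by apply: (period_eq_common (a := 0%R) p0 pz pz'); exact: window_eq.
Qed.

(** Points of large period are coded with blocks only and the others by the
    given comparison.  The bound n0 depends on the blocks alone: a word that
    avoids the blocks and the small periods can be chosen after it, and then
    avoids the labels of all the coded points. *)
Theorem periodic_code : exists n0 (theta : (int -> C) -> (int -> V)),
  (forall z n, Z z -> exact_period z n ->
    [/\ bipath e (theta z), theta (shiftZ z) = shiftZ (theta z), exact_period (lam \o theta z) n &
        n0 <= n -> in_blocks (lam \o theta z)]) /\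
  (forall z z' n n', Z z -> exact_period z n -> Z z' -> exact_period z' n' ->
     lam \o theta z = lam \o theta z' -> z = z').
Proof.
have [n0 large] := large_periods.
have H n : exists h : (int -> C) -> (int -> V),
  (forall z, Z z /\ exact_period z n -> [/\ bipath e (h z) /\ (n0 <= n -> in_blocks (lam \o h z)),
     h (shiftZ z) = shiftZ (h z) & exact_period (lam \o h z) n]) /\
  (forall z z', Z z /\ exact_period z n -> Z z' /\ exact_period z' n ->
     lam \o h z = lam \o h z' -> z = z').
  have [->|n_gt0] := posnP n.
    by exists (fun _ _ => alpha); split=> [z|z z'] [_ []].
  pose D x := bipath e x /\ (n0 <= n -> in_blocks (lam \o x)).
  have hD x : D x -> D (shiftZ x).
    by move=> [a b]; split=> [i|/b]; [exact: a | exact: in_blocks_sh].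
  have [g [g1 g2]] : exists g : (int -> C) -> (int -> B),
    (forall z, Z z /\ exact_period z n -> exact_period (g z) n /\
       exists x, [/\ D x, period n x & lam \o x = g z]) /\
    (forall z z', Z z /\ exact_period z n -> Z z' /\ exact_period z' n -> g z = g z' -> z = z').
    case: (leqP n0 n) => hn.
      have [g [g1 g2]] := large n hn; exists g; split.
        move=> z [hz hl]; have [a [x [b1 b2 b3 b4]]] := g1 z hz hl.
        by split=> //; exists x.
      by move=> z z' [a b] [c d]; exact: g2.
    have [g [g1 g2]] := small n_gt0; exists g; split.
      move=> z [hz hl]; have [a [x [b1 b2 b3]]] := g1 z hz hl.
      by split=> //; exists x; split=> //; split=> //; rewrite leqNgt hn.
    by move=> z z' [a b] [c d]; exact: g2.
  apply: (lift_periodic alpha (D := D) (g := g)) => //.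
  - by move=> z [hz hl]; split; [exact: Z_sh | exact: exact_period_sh].
  - by move=> z [].
have [h hP] := choice H.
have Hn (z : int -> C) : exists n, (exists m, exact_period z m) -> exact_period z n.
  case: (pselect (exists m, exact_period z m)) => [[m hm]|no]; first by exists m.
  by exists 0 => /no.
have [nu nuP] := choice Hn.
have nuE (z : int -> C) n : exact_period z n -> nu z = n.
  by move=> hl; apply: (exact_period_uniq _ hl); apply: nuP; exists n.
exists n0, (fun z => h (nu z) z); split.
  move=> z n hz hl; have [/(_ z (conj hz hl)) [[a b] c d] _] := hP n.
  by split=> /=; rewrite ?(nuE _ _ hl) ?(nuE _ _ (exact_period_sh hl)).
move=> z z' n n' hz hl hz' hl'; rewrite (nuE _ _ hl) (nuE _ _ hl') => E.
have [/(_ z (conj hz hl)) [_ _ l1] _] := hP n.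
have [/(_ z' (conj hz' hl')) [_ _ l2] _] := hP n'.
have En : n = n' by rewrite E in l1; exact: exact_period_uniq l1 l2.
rewrite -En in E hl' *; have [_ inj] := hP n; exact: inj E.
Qed.

End Theta.

(** * Marker positions *)

Local Open Scope ring_scope.
Section Extension.
Variables (C : finType) (Z : (int -> C) -> Prop).
Hypothesis Z_shift : forall (j : int) z, Z z -> Z (fun i => z (i + j)).
Hypothesis Z_closed : forall x, (forall m : nat, exists z, Z z /\
  forall i : int, `|i| <= m%:Z -> z i = x i) -> Z x.

(** There are finitely many periodic sequences of period less than N, so one
    radius excludes all those that do not belong to Z. *)
Lemma periodic_extension N : exists R0 : nat, forall (R : nat) z (i : int) (p : nat),
  (R0 <= R)%N -> Z z -> (0 < p < N)%N ->
  (forall j : int, i - R%:Z <= j -> j + p%:Z <= i + R%:Z -> z (j + p%:Z) = z j) ->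
  exists zh, [/\ Z zh, period p zh & forall j, `|j - i| <= R%:Z -> zh j = z j].
Proof.
case: (pselect (exists c : C, True)) => [[c0 _]|noC]; last first.
  by exists 0%N => R z i; exfalso; apply: noC; exists (z 0).
pose cp (x : 'I_N * N.-tuple C) : int -> C :=
  fun i => nth c0 x.2 `|(i %% (x.1 : nat)%:Z)%Z|%N.
have H x : exists m : nat, Z (cp x) \/
    ~ exists z, Z z /\ forall i : int, `|i| <= m%:Z -> z i = cp x i.
  case: (pselect (Z (cp x))) => [h|h]; first by exists 0%N; left.
  apply: contrapT => /forallNP h'; apply: h; apply: Z_closed => m.
  by apply: contrapT => hm; apply: (h' m); right.
have [m mP] := choice H.
exists (\max_x m x + N)%N => R z i p hR hz /andP[p0 pN] hp.
pose w j := z (j + i).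
have hw : Z w by exact: Z_shift.
have wstep (n : nat) (j : int) : - R%:Z <= j -> j + n%:Z * p%:Z <= R%:Z ->
    w (j + n%:Z * p%:Z) = w j.
  elim: n => [|n IH] h1 h2; first by congr w; lia.
  rewrite -IH //; last by lia.
  rewrite /w -(hp (j + n%:Z * p%:Z + i)); try lia.
  by congr z; lia.
have st : size (window w 0 N) == N by rewrite size_window.
pose x : 'I_N * N.-tuple C := (Ordinal pN, Tuple st).
have D0 : p%:Z != 0 by lia.
have agree j : `|j| <= R%:Z -> w j = cp x j.
  move=> hj; rewrite /cp /=.
  have h0 := modz_ge0 j D0; have h1 := ltz_pmod j (_ : 0 < p%:Z).
  have {}h1 := h1 ltac:(lia).
  rewrite nth_window; last by lia.
  rewrite add0r gez0_abs // {1}(divz_eq j p%:Z).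
  have E := divz_eq j p%:Z.
  set r := (j %% p)%Z in h0 h1 E *; set q := (j %/ p)%Z in E *.
  case: (lerP 0 q) => hq.
    have E2 := wstep `|q|%N r; rewrite gez0_abs // in E2.
    by rewrite -E2; [congr w; ring | lia | lia].
  have hq' : `|q|%N%:Z = - q by lia.
  have E2 := wstep `|q|%N (q * p%:Z + r); rewrite hq' in E2.
  by rewrite -E2; [congr w; ring | lia | lia].
have hx : Z (cp x).
  case: (mP x) => // no; exfalso; apply: no; exists w; split=> // j hj.
  apply: agree; have : (m x <= \max_x m x)%N by exact: leq_bigmax.
  lia.
exists (fun j => cp x (j - i)); split; first exact: Z_shift.
  by move=> j; rewrite /cp /= (_ : j + p%:Z - i = j - i + p%:Z) ?modzDr //; lia.
by move=> j hj; rewrite -agree // /w subrK.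
Qed.

End Extension.

Section Markers.
Variables (C : finType) (n N : nat).

(** Greedy placement: the words of the list are treated from the last to the
    first, and an occurrence is marked if no mark is closer than N yet. *)
Fixpoint mark (ws : seq (seq C)) (z : int -> C) (i : int) : bool :=
  if ws is w :: ws' then
    mark ws' z i ||
    (window z (i - n%:Z) (n + n).+1 == w) &&
    all (fun k : nat => ~~ mark ws' z (i + k%:Z) && ~~ mark ws' z (i - k%:Z)) (iota 0 N)
  else false.

Definition has_period p (w : seq C) := drop p w == take (size w - p) w.

Lemma has_period_window p (z : int -> C) (a : int) L : (p <= L)%N ->
  has_period p (window z a L) <->
  (forall j : int, a <= j -> j + p%:Z < a + L%:Z -> z (j + p%:Z) = z j).
Proof.
move=> hp; rewrite /has_period size_window.
have -> : drop p (window z a L) = window z (a + p%:Z) (L - p).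
  by rewrite -{1}(subnKC hp) window_cat drop_size_cat ?size_window.
have -> : take (L - p) (window z a L) = window z a (L - p).
  by rewrite -{2}(subnK hp) window_cat take_size_cat ?size_window.
split.
  move=> /eqP h j h1 h2; have := window_eq h (k := `|j - a|%N) ltac:(lia).
  have -> : a + p%:Z + `|j - a|%N%:Z = j + p%:Z by lia.
  by have -> : a + `|j - a|%N%:Z = j by lia.
move=> h; apply/eqP/eq_window => k hk.
by rewrite -[RHS]h; [congr z; lia | lia | lia].
Qed.

Definition aperiodic (w : seq C) := all (fun p => ~~ has_period p w) (iota 1 N.-1).

(** Two marks made by the same word at distance p < N would give this word the
    period p; marks made by different words are separated by construction. *)
Lemma mark_separated ws z i j : (N <= n)%N -> all aperiodic ws ->
  mark ws z i -> mark ws z j -> i < j -> i + N%:Z <= j.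
Proof.
move=> nN; elim: ws i j => //= w ws IH i j /andP[hw hws].
case/orP=> [hi|/andP[/eqP wi hi]]; case/orP=> [hj|/andP[/eqP wj hj]] hij.
- exact: IH.
- rewrite leNgt; apply/negP => hlt.
  have := allP hj `|j - i|%N; rewrite mem_iota => /(_ ltac:(lia))/andP[_].
  by rewrite (_ : j - _ = i) ?hi //; lia.
- rewrite leNgt; apply/negP => hlt.
  have := allP hi `|j - i|%N; rewrite mem_iota => /(_ ltac:(lia))/andP[+ _].
  by rewrite (_ : i + _ = j) ?hj //; lia.
rewrite leNgt; apply/negP => hlt.
have := allP hw `|j - i|%N; rewrite mem_iota => /(_ ltac:(lia))/negP; apply.
rewrite -wi; apply/has_period_window; first by lia.
move=> x h1 h2; pose k := absz ((x : int) - (i - n%:Z))%R.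
have ek : i - n%:Z + k%:Z = x by rewrite /k; lia.
have kn : (k < (n + n).+1)%N by rewrite /k; lia.
have := window_eq (etrans wi (esym wj)) kn; rewrite ek => ->.
by congr z; lia.
Qed.

(** A listed word is marked at its own turn unless an earlier mark is near. *)
Lemma mark_near ws z i : (0 < N)%N -> window z (i - n%:Z) (n + n).+1 \in ws ->
  exists j, `|j - i| < N%:Z /\ mark ws z j.
Proof.
move=> N0; elim: ws => //= w ws IH; rewrite inE => /orP[/eqP E|/IH[j [h1 h2]]]; last first.
  by exists j; rewrite h2.
case: (boolP (all (fun k : nat => ~~ mark ws z (i + k%:Z) && ~~ mark ws z (i - k%:Z))
   (iota 0 N))) => [ha|/allPn[k]].
  by exists i; rewrite subrr normr0; split; [lia | rewrite E eqxx ha orbT].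
rewrite mem_iota negb_and !negbK => hk /orP[h|h].
  by exists (i + k%:Z); rewrite h; split=> //; lia.
by exists (i - k%:Z); rewrite h; split=> //; lia.
Qed.

Lemma mark_shift ws z i j : mark ws (fun k => z (k + j)) i = mark ws z (i + j).
Proof.
elim: ws i => //= w ws IH i; rewrite IH; congr (_ || _ && _).
  by congr (_ == _); apply: eq_window => k _; congr z; lia.
apply: eq_all => k; rewrite !IH; congr (~~ mark _ _ _ && ~~ mark _ _ _); lia.
Qed.

Lemma mark_local ws z z' i :
  (forall j, `|j - i| <= (n + N * size ws)%N%:Z -> z j = z' j) ->
  mark ws z i = mark ws z' i.
Proof.
elim: ws i => //= w ws IH i h.
have hm j : `|j - i| < N%:Z \/ j = i -> mark ws z j = mark ws z' j.
  by move=> hj; apply: IH => k hk; apply: h; lia.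
rewrite hm; last by right.
congr (_ || _ && _).
  by congr (_ == _); apply: eq_window => k hk; apply: h; lia.
by apply: eq_in_all => k; rewrite mem_iota => hk; rewrite !hm //; left; lia.
Qed.

End Markers.

Section MarkerLemma.
Variables (C : finType) (Z : (int -> C) -> Prop).
Hypothesis Z_shift : forall (j : int) z, Z z -> Z (fun i => z (i + j)).
Hypothesis Z_closed : forall x, (forall m : nat, exists z, Z z /\
  forall i : int, `|i| <= m%:Z -> z i = x i) -> Z x.

(** Every word without a period less than N is listed, so a position with no
    mark near it is surrounded by a word with such a period, and this word
    extends to a periodic point of Z. *)
Theorem marker_lemma (N R : nat) : (0 < N)%N ->
  exists (marked : (int -> C) -> int -> bool) (Q : nat),
  [/\ forall z i j, marked (fun k => z (k + j)) i = marked z (i + j),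
      forall z z' i, (forall j, `|j - i| <= Q%:Z -> z j = z' j) -> marked z i = marked z' i,
      forall z i j, marked z i -> marked z j -> i < j -> i + N%:Z <= j &
      forall z i, Z z -> (forall j, `|j - i| < N%:Z -> ~~ marked z j) ->
        exists zh p, [/\ (0 < p < N)%N, Z zh, period p zh &
          forall j, `|j - i| <= R%:Z -> zh j = z j]].
Proof.
move=> N0; have [R0 hR0] := periodic_extension Z_shift Z_closed N.
pose n := (R0 + R + N)%N.
pose ws := [seq val t | t <- enum {: (n + n).+1.-tuple C} & aperiodic N (val t)].
exists (mark n N ws), (n + N * size ws)%N; split.
- by move=> z i j; exact: mark_shift.
- by move=> z z' i; exact: mark_local.
- move=> z i j; apply: mark_separated; first by rewrite /n; lia.
  by apply/allP => w /mapP[t]; rewrite mem_filter => /andP[h _] ->.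
move=> z i hz no.
have : ~~ aperiodic N (window z (i - n%:Z) (n + n).+1).
  apply/negP => ha.
  have sw : size (window z (i - n%:Z) (n + n).+1) == (n + n).+1 by rewrite size_window.
  have [|j [h1 h2]] := @mark_near C n N ws z i N0.
    by apply/mapP; exists (Tuple sw) => //; rewrite mem_filter ha mem_enum.
  by have := no j h1; rewrite h2.
case/allPn=> p; rewrite mem_iota negbK => hp /has_period_window h.
have {}h := h ltac:(rewrite /n; lia).
have [||j h1 h2|zh [h1 h2 h3]] := hR0 n z i p _ hz; try (rewrite /n; lia).
  by apply: h; lia.
exists zh, p; split=> //; first by lia.
by move=> j hj; apply: h3; rewrite /n; lia.
Qed.

End MarkerLemma.

(** * The marker word *)

Local Close Scope ring_scope.
Section Occurs.
Variables (V B : finType) (lam : V -> B) (n : nat) (u : seq B).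
Hypothesis n_gt0 : 0 < n.
Hypothesis size_u : size u = n.

Definition occurs (m : seq V) j := take n (drop j (map lam m)) == u.

Lemma occurs_leq m j : occurs m j -> j + n <= size m.
Proof.
move=> /eqP h; have := congr1 size h; rewrite size_u size_take size_drop size_map.
by case: ltnP; lia.
Qed.

End Occurs.

Section MarkerWord.
Variables (V B : finType) (e : rel V) (lam : V -> B).
Variables (G : nat) (conn : V -> V -> seq V) (alpha : V).
Hypothesis G_gt0 : 0 < G.
Hypothesis conn_walk : forall s t, walk e s (conn s t) t.
Hypothesis size_conn : forall s t, size (conn s t) = G.
Variables (BT : finType) (blk : BT -> seq V) (b0 : BT).
Hypothesis blk_walk : forall b, walk e alpha (blk b) alpha.
Hypothesis blk_gt0 : 0 < size (blk b0).
Variables (n : nat) (u : seq B).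
Hypothesis n_gt0 : 0 < n.
Hypothesis size_u : size u = n.
Hypothesis u_rare : forall bs, ~~ infix u (map lam (flatten (map blk bs))).

(** A loop with two copies of u, padded with blocks so that the occurrences of u
    near it do not depend on what surrounds it.  The extreme occurrences are
    so far apart that no connecting word of length G meets copies of u at the
    distance hi - lo, and the pads are so long that nothing outside the loop is
    at this distance from an occurrence in it. *)
Lemma marker_word : u \in [seq val t | t in labels e lam n] ->
  exists (ps : seq BT) (core : seq V) (lo hi : nat),
  let pad := flatten (map blk ps) in let m := pad ++ core ++ pad in
  [/\ walk e alpha m alpha, occurs lam n u m lo, occurs lam n u m hi &
      forall j, occurs lam n u m j -> lo <= j <= hi] /\
  [/\ n + G <= hi - lo, hi < size pad + size core, size pad < lo + n &
      hi - lo + n + n + G <= size pad].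
Proof.
move=> /imageP[t /(labelsP _ _ _ n_gt0)[s [p [hp sp Eu]]] Et].
have {}Eu : map lam (s :: p) = u by rewrite Eu Et.
pose c := detour conn alpha s p.
have sc : size c = G + (n.-1 + G) by rewrite /c (size_detour alpha size_conn) sp.
(* With one loop the extreme occurrences of u might coincide; two loops keep them
   at least size c >= n + G apart. *)
pose core := c ++ c.
pose S := size core + 4 * n + G.
pose ps := nseq S b0; pose pad := flatten (map blk ps).
have padS : S <= size pad.
  have H k : k <= size (flatten (map blk (nseq k b0))).
    by elim: k => // k IH; rewrite /= size_cat -add1n leq_add.
  exact: H.
pose m := pad ++ core ++ pad.
have wc : walk e alpha c alpha by exact: detour_walk.
have wm : walk e alpha m alpha.
  have wp : walk e alpha pad alpha by apply: walk_flatten => l /mapP[b _ ->].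
  exact: walk_cat wp (walk_cat (walk_cat wc wc) wp).
have wd r : take n (drop G (map lam (c ++ r))) = u.
  rewrite -map_drop -map_take -(prednK n_gt0) -sp.
  by rewrite (detour_word alpha G_gt0 conn_walk size_conn) Eu.
have occ_cat (l r : seq V) : m = l ++ c ++ r -> occurs lam n u m (size l + G).
  move=> ->; apply/eqP.
  by rewrite addnC -drop_drop map_cat drop_size_cat ?size_map.
have o1 : occurs lam n u m (size pad + G) by apply: (occ_cat _ (c ++ pad)); rewrite /m /core -catA.
have o2 : occurs lam n u m (size (pad ++ c) + G).
  by apply: (occ_cat _ pad); rewrite /m /core -!catA.
have occ_range j : occurs lam n u m j -> size pad < j + n /\ j < size pad + size core.
  move=> hj; have hjm := occurs_leq n_gt0 size_u hj; move/eqP: hj => hj.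
  split; rewrite ltnNge; apply/negP => h.
    have /negP := u_rare ps; apply; rewrite -/pad -hj.
    have -> : take n (drop j (map lam m)) = take n (drop j (map lam pad)).
      rewrite /m map_cat drop_cat size_map; case: ltnP => hjp; last by lia.
      rewrite take_cat size_drop size_map; case: ltnP => // hn.
      have -> : n - (size pad - j) = 0 by lia.
      by rewrite take0 cats0 take_oversize // size_drop size_map; lia.
    exact: infix_trans (infix_take _ _) (infix_drop _ _).
  have /negP := u_rare ps; apply; rewrite -/pad -hj /m catA map_cat drop_cat.
  rewrite size_map size_cat ltnNge h /=.
  exact: infix_trans (infix_take _ _) (infix_drop _ _).
have ex : exists j, occurs lam n u m j by exists (size pad + G).
have bd j : occurs lam n u m j -> j <= size m by move=> /(occurs_leq n_gt0 size_u); lia.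
case: (ex_minnP ex) => lo olo hlo; case: (ex_maxnP ex bd) => hi ohi hhi.
exists ps, core, lo, hi; split; first by split=> // j hj; rewrite hlo // hhi.
have [l1 l2] := occ_range _ olo; have [h1 h2] := occ_range _ ohi.
have := hlo _ o1; have := hhi _ o2; rewrite size_cat sc.
have score : size core = size c + size c by rewrite /core size_cat.
by rewrite -/pad; split; rewrite /S in padS; lia.
Qed.

End MarkerWord.

(** * The code *)

Local Open Scope ring_scope.
Section Nearest.
Variable (P : int -> bool).

(** A mark at i itself counts as the nearest one before i, at distance 0, so
    that a gap contains its left end only. *)
Definition before (T : nat) (i : int) := ohead [seq k <- iota 0 T | P (i - k%:Z)].
Definition after (T : nat) (i : int) := ohead [seq k <- iota 1 T | P (i + k%:Z)].

Lemma ohead_filter_iota (p : pred nat) a T :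
  match ohead [seq k <- iota a T | p k] with
  | Some k => [/\ (a <= k < a + T)%N, p k & forall j, (a <= j < k)%N -> ~~ p j]
  | None => forall j, (a <= j < a + T)%N -> ~~ p j
  end.
Proof.
elim: T a => [|T IH] a /=; first by move=> j; lia.
case: ifP => /= pa.
  by split=> //; [lia | move=> j; lia].
have := IH a.+1; case: (ohead _) => [k [h1 h2 h3]|h].
  split=> //; first by lia.
  move=> j hj; case: (eqVneq j a) => [->|ne]; first by rewrite pa.
  by apply: h3; lia.
move=> j hj; case: (eqVneq j a) => [->|ne]; first by rewrite pa.
by apply: h; lia.
Qed.

Lemma beforeP T i : match before T i with
  | Some k => [/\ (k < T)%N, P (i - k%:Z) & forall j, i - k%:Z < j <= i -> ~~ P j]
  | None => forall j, i - T%:Z < j <= i -> ~~ P j end.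
Proof.
rewrite /before; have := ohead_filter_iota (fun k => P (i - k%:Z)) 0 T.
case: (ohead _) => [k [h1 h2 h3]|h].
  split; [by lia | by [] |].
  move=> j hj; have := h3 `|i - j|%N; have -> : i - `|i - j|%N%:Z = j by lia.
  by apply; lia.
move=> j hj; have := h `|i - j|%N; have -> : i - `|i - j|%N%:Z = j by lia.
by apply; lia.
Qed.

Lemma afterP T i : match after T i with
  | Some k => [/\ (0 < k <= T)%N, P (i + k%:Z) & forall j, i < j < i + k%:Z -> ~~ P j]
  | None => forall j, i < j <= i + T%:Z -> ~~ P j end.
Proof.
rewrite /after; have := ohead_filter_iota (fun k => P (i + k%:Z)) 1 T.
case: (ohead _) => [k [h1 h2 h3]|h].
  split; [by lia | by [] |].
  move=> j hj; have := h3 `|j - i|%N; have -> : i + `|j - i|%N%:Z = j by lia.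
  by apply; lia.
move=> j hj; have := h `|j - i|%N; have -> : i + `|j - i|%N%:Z = j by lia.
by apply; lia.
Qed.

Lemma before_eq (T : nat) i a : P a -> a <= i -> i - a < T%:Z ->
  (forall j, a < j <= i -> ~~ P j) -> before T i = Some `|i - a|%N.
Proof.
move=> Pa h1 h2 h3; have := beforeP T i; case: (before T i) => [k [k1 k2 k3]|h].
  congr Some; case: (ltrgtP (i - k%:Z) a) => hk; last by lia.
    by have := k3 a ltac:(lia); rewrite Pa.
  by have := h3 (i - k%:Z) ltac:(lia); rewrite k2.
by have := h a ltac:(lia); rewrite Pa.
Qed.

Lemma after_eq (T : nat) i b : P b -> i < b -> b - i <= T%:Z ->
  (forall j, i < j < b -> ~~ P j) -> after T i = Some `|b - i|%N.
Proof.
move=> Pb h1 h2 h3; have := afterP T i; case: (after T i) => [k [k1 k2 k3]|h].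
  congr Some; case: (ltrgtP (i + k%:Z) b) => hk; last by lia.
    by have := h3 (i + k%:Z) ltac:(lia); rewrite k2.
  by have := k3 b ltac:(lia); rewrite Pb.
by have := h b ltac:(lia); rewrite Pb.
Qed.

End Nearest.

Lemma before_ext (P P' : int -> bool) (T : nat) (i i' : int) :
  (forall k : nat, (k < T)%N -> P (i - k%:Z) = P' (i' - k%:Z)) ->
  before P T i = before P' T i'.
Proof.
move=> h; rewrite /before; congr ohead; apply: eq_in_filter => k.
by rewrite mem_iota => hk; apply: h; lia.
Qed.

Lemma after_ext (P P' : int -> bool) (T : nat) (i i' : int) :
  (forall k : nat, (k <= T)%N -> P (i + k%:Z) = P' (i' + k%:Z)) ->
  after P T i = after P' T i'.
Proof.
move=> h; rewrite /after; congr ohead; apply: eq_in_filter => k.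
by rewrite mem_iota => hk; apply: h; lia.
Qed.

Section Code.
Variables (V B C : finType) (e : rel V) (lam : V -> B).
Variables (G : nat) (conn : V -> V -> seq V) (alpha : V).
Hypothesis G_gt0 : (0 < G)%N.
Hypothesis conn_walk : forall s t, walk e s (conn s t) t.
Hypothesis size_conn : forall s t, size (conn s t) = G.

Variable (Z : (int -> C) -> Prop).
Hypothesis Z_shift : forall (j : int) z, Z z -> Z (fun i => z (i + j)).

(** Of the marker word m, the data words [short], the marks and the map theta on
    periodic points, only the properties assumed below matter to the code. *)
Variables (m : seq V) (N T : nat) (short : nat -> seq C -> seq V).
Let Lm := size m.
Hypothesis Lm_gt0 : (0 < Lm)%N.
Hypothesis m_walk : walk e alpha m alpha.
Hypothesis N_big : (Lm + G < N)%N.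
Hypothesis T_big : (N + N + N * N + Lm + G + G < T)%N.
Hypothesis size_short : forall L w, (N <= L)%N -> size (short L w) = L.
Hypothesis short_walk : forall L w, walk e alpha (short L w) alpha.
Hypothesis short_m : forall L w, take Lm (short L w) = m.

Variables (marked : (int -> C) -> int -> bool) (Q : nat).
Let R := (N * N + T)%N.
Hypothesis marked_shift : forall (z : int -> C) (i j : int), marked (fun k => z (k + j)) i = marked z (i + j).
Hypothesis marked_local : forall (z z' : int -> C) (i : int), (forall j : int, `|j - i| <= Q%:Z -> z j = z' j) ->
  marked z i = marked z' i.
Hypothesis marked_sep : forall (z : int -> C) (i j : int), marked z i -> marked z j -> i < j -> i + N%:Z <= j.

(** The radius R exceeds T by N * N: approximants at positions at most T apart
    agree on N * N letters, hence coincide. *)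
Definition approx (z : int -> C) (i : int) zh := [/\ Z zh, exists p, (0 < p < N)%N /\ period p zh &
  forall j : int, `|j - i| <= R%:Z -> zh j = z j].

Hypothesis marked_none : forall (z : int -> C) (i : int), Z z -> (forall j : int, `|j - i| < N%:Z -> ~~ marked z j) ->
  exists zh p, [/\ (0 < p < N)%N, Z zh, period p zh &
    forall j : int, `|j - i| <= (N + R)%N%:Z -> zh j = z j].

Variable (theta : (int -> C) -> (int -> V)).
Definition periodic_pt z := Z z /\ exists p, (0 < p)%N /\ period p z.
Hypothesis theta_path : forall z, periodic_pt z -> bipath e (theta z).
Hypothesis theta_sh : forall z, periodic_pt z -> theta (shiftZ z) = shiftZ (theta z).

Lemma approx_per z (i : int) zh : approx z i zh -> periodic_pt zh.
Proof. by move=> [h [p [/andP[p0 _] hp]] _]; split=> //; exists p. Qed.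

Lemma approx_uniq z (i j : int) zh zh' : `|i - j| <= T%:Z ->
  approx z i zh -> approx z j zh' -> zh = zh'.
Proof.
move=> hij [_ [p [/andP[p0 pN] hp]] h] [_ [p' [/andP[p0' pN'] hp']] h'].
apply: (period_eq (a := Num.max i j - R%:Z) p0 p0' hp hp') => k hk.
have hNN : (p * p' <= N * N)%N by apply: leq_mul; exact: ltnW.
by rewrite h ?h' //; move: hij hk hNN; rewrite /R; lia.
Qed.

(** The choice depends on the predicate alone; this is what makes the code
    locally determined. *)
Definition point_of (P : (int -> C) -> Prop) : int -> V :=
  if pselect (exists zh, P zh) is left h then theta (projT1 (cid h))
  else fun=> alpha.
Definition periodic_part z (i : int) := point_of (approx z i).

Lemma periodic_partE z i zh : approx z i zh -> periodic_part z i = theta zh.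
Proof.
move=> h; rewrite /periodic_part /point_of; case: pselect => [h'|no].
  congr theta; apply: (approx_uniq _ (projT2 (cid h')) h); rewrite subrr; lia.
by exfalso; apply: no; exists zh.
Qed.

(** In a gap between marks less than T apart the code writes a word [short].  In
    a longer gap it writes m, a connecting word, the image of the periodic
    approximant, and a connecting word back to alpha just before the next mark. *)
Definition code (z : int -> C) (i : int) : V :=
  let between ok ok' :=
    match ok with
    | Some k => if (k < Lm + G)%N then
        nth alpha (m ++ conn alpha (periodic_part z i (i - k%:Z + (Lm + G)%N%:Z))) k
      else if ok' is Some k' then
        if (k' <= G)%N then nth alpha (conn (periodic_part z i (i + k'%:Z - G%:Z)) alpha) (G - k')
        else periodic_part z i i
      else periodic_part z i i
    | None => if ok' is Some k' then
        if (k' <= G)%N then nth alpha (conn (periodic_part z i (i + k'%:Z - G%:Z)) alpha) (G - k')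
        else periodic_part z i i
      else periodic_part z i i
    end in
  match before (marked z) T i, after (marked z) T i with
  | Some k, Some k' => if (k + k' < T)%N then
      nth alpha (short (k + k') (window z (i - k%:Z) (k + k'))) k
      else between (Some k) (Some k')
  | ok, ok' => between ok ok'
  end.

(** Gaps without a first or a last mark count as long. *)
Definition long z (i : int) := forall a b : int, marked z a -> marked z b -> a <= i < b -> a + T%:Z <= b.

Lemma code_short z (a b i : int) : marked z a -> marked z b -> a <= i < b -> b < a + T%:Z ->
  (forall j, a < j < b -> ~~ marked z j) ->
  code z i = nth alpha (short `|b - a|%N (window z a `|b - a|%N)) `|i - a|%N.
Proof.
move=> ha hb hi hT no.
rewrite /code (before_eq (T := T) ha) ?(after_eq (T := T) hb); try lia; first last.
- by move=> j hj; apply: no; lia.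
- by move=> j hj; apply: no; lia.
have -> : (`|i - a| + `|b - i|)%N = `|b - a|%N by lia.
have -> : (`|b - a| < T)%N by lia.
by have -> : i - `|i - a|%N%:Z = a by lia.
Qed.

Lemma code_left z (a i : int) : marked z a -> a <= i -> i < a + (Lm + G)%N%:Z ->
  (forall j, a < j < a + T%:Z -> ~~ marked z j) ->
  code z i = nth alpha (m ++ conn alpha (periodic_part z i (a + (Lm + G)%N%:Z))) `|i - a|%N.
Proof.
move=> ha h1 h2 no; rewrite /code (before_eq (T := T) ha) //; last 2 first.
- by lia.
- by move=> j hj; apply: no; lia.
have -> : (`|i - a| < Lm + G)%N by lia.
have -> : i - `|i - a|%N%:Z = a by lia.
have := afterP (marked z) T i; case: (after _ _ _) => // k [k1 k2 k3].
have -> // : (`|i - a| + k < T)%N = false.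
apply/negP => hk; have := no (i + k%:Z) ltac:(lia); by rewrite k2.
Qed.

Lemma code_right z (b i : int) : marked z b -> i < b -> b <= i + G%:Z ->
  (forall j, b - T%:Z < j < b -> ~~ marked z j) ->
  code z i = nth alpha (conn (periodic_part z i (b - G%:Z)) alpha) `|(i - (b - G%:Z))%R|%N.
Proof.
move=> hb h1 h2 no; rewrite /code (after_eq (T := T) hb) //; last 2 first.
- by lia.
- by move=> j hj; apply: no; lia.
have -> : (`|b - i| <= G)%N by lia.
have -> : (G - `|b - i|)%N = `|(i - (b - G%:Z))%R|%N by lia.
have -> : i + `|b - i|%N%:Z = b by lia.
have := beforeP (marked z) T i; case: (before _ _ _) => // k [k1 k2 k3].
have hk : (T <= k + `|b - i|)%N.
  rewrite leqNgt; apply/negP => hk; have := no (i - k%:Z) ltac:(lia); by rewrite k2.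
rewrite ltnNge hk /=.
by have -> : (k < Lm + G)%N = false by lia.
Qed.

Lemma code_mid z (i : int) : long z i ->
  (forall j, i - (Lm + G)%N%:Z < j <= i + G%:Z -> ~~ marked z j) ->
  code z i = periodic_part z i i.
Proof.
move=> hl no; rewrite /code.
have := beforeP (marked z) T i; have := afterP (marked z) T i.
case: (after _ _ _) => [k' [a1 a2 a3]|_]; case: (before _ _ _) => [k [b1 b2 b3]|_].
- have -> : (k + k' < T)%N = false by have := hl _ _ b2 a2; lia.
  case: ifP => [hk|_]; first by have := no (i - k%:Z) ltac:(lia); rewrite b2.
  by case: ifP => // hk; have := no (i + k'%:Z) ltac:(lia); rewrite a2.
- by case: ifP => // hk; have := no (i + k'%:Z) ltac:(lia); rewrite a2.
- by case: ifP => // hk; have := no (i - k%:Z) ltac:(lia); rewrite b2.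
- by [].
Qed.

Lemma short_or_long z (i : int) :
  (exists a b : int, [/\ marked z a, marked z b, a <= i < b, b < a + T%:Z &
     forall j : int, a < j < b -> ~~ marked z j]) \/ long z i.
Proof.
have := beforeP (marked z) T i; have := afterP (marked z) T i.
case: (after _ _ _) => [k' [a1 a2 a3]|h']; case: (before _ _ _) => [k [b1 b2 b3]|h].
- case: (ltnP (k + k') T) => hk.
    left; exists (i - k%:Z), (i + k'%:Z); split=> //; try lia.
    move=> j hj; case: (leP j i) => hji; first by apply: b3; lia.
    by apply: a3; lia.
  right=> a b ha hb hab.
  have : a <= i - k%:Z.
    by rewrite leNgt; apply/negP => hlt; have := b3 a ltac:(lia); rewrite ha.
  have : i + k'%:Z <= b; last by lia.
  by rewrite leNgt; apply/negP => hlt; have := a3 b ltac:(lia); rewrite hb.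
- right=> a b ha hb hab; rewrite leNgt; apply/negP => hlt.
  by have := h a ltac:(lia); rewrite ha.
- right=> a b ha hb hab; rewrite leNgt; apply/negP => hlt.
  by have := h' b ltac:(lia); rewrite hb.
- right=> a b ha hb hab; rewrite leNgt; apply/negP => hlt.
  by have := h' b ltac:(lia); rewrite hb.
Qed.

Lemma last_mark z (k : nat) (i : int) : (forall j : int, i - k%:Z < j <= i -> ~~ marked z j) \/
  exists a : int, [/\ marked z a, i - k%:Z < a <= i & forall j : int, a < j <= i -> ~~ marked z j].
Proof.
have := beforeP (marked z) k i; case: (before _ _ _) => [l [b1 b2 b3]|h]; last by left.
by right; exists (i - l%:Z); split=> //; lia.
Qed.

Lemma next_mark z (k : nat) (i : int) : (forall j : int, i < j <= i + k%:Z -> ~~ marked z j) \/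
  exists b : int, [/\ marked z b, i < b <= i + k%:Z & forall j : int, i < j < b -> ~~ marked z j].
Proof.
have := afterP (marked z) k i; case: (after _ _ _) => [l [b1 b2 b3]|h]; last by left.
by right; exists (i + l%:Z); split=> //; lia.
Qed.

Lemma gap_right z (a i : int) : long z i -> marked z a -> a <= i ->
  (forall j : int, a < j <= i -> ~~ marked z j) ->
  forall j : int, a < j < a + T%:Z -> ~~ marked z j.
Proof.
move=> hl ha hai no j hj; case: (leP j i) => hji; first by apply: no; lia.
by apply/negP => hmj; have := hl a j ha hmj ltac:(lia); lia.
Qed.

Lemma gap_left z (b i : int) : long z i -> marked z b -> i < b ->
  (forall j : int, i < j < b -> ~~ marked z j) ->
  forall j : int, b - T%:Z < j < b -> ~~ marked z j.
Proof.
move=> hl hb hib no j hj; case: (leP j i) => hji; last by apply: no; lia.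
by apply/negP => hmj; have := hl j b hmj hb ltac:(lia); lia.
Qed.

Lemma long_same z (i k : int) : i <= k -> (forall j : int, i < j <= k -> ~~ marked z j) ->
  long z i <-> long z k.
Proof.
move=> hik no; split=> h a b ha hb hab; apply: h => //.
  case: (leP a i) => hai; last by have := no a ltac:(lia); rewrite ha.
  by lia.
case: (leP b k) => hbk; first by have := no b ltac:(lia); rewrite hb.
by lia.
Qed.

(** Near the ends of a long gap the approximant is taken at the closest position
    at distance N from the mark; this costs N in the radius. *)
Lemma long_approx z (i : int) : Z z -> long z i -> exists zh, approx z i zh.
Proof.
move=> hz hl.
suff [i0 [h1 h2]] : exists i0 : int, `|i - i0| <= N%:Z /\
    forall j : int, `|j - i0| < N%:Z -> ~~ marked z j.
  have [zh [p [p1 p2 p3 p4]]] := marked_none hz h2.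
  exists zh; split=> //; first by exists p.
  by move=> j hj; apply: p4; move: h1 hj; rewrite /R; lia.
case: (last_mark z N i) => [no1|[a [ha h1 h2]]]; last first.
  exists (a + N%:Z); split; first by lia.
  by move=> j hj; apply: (gap_right hl ha) => //; lia.
case: (next_mark z N i) => [no2|[b [hb h3 h4]]]; last first.
  exists (b - N%:Z); split; first by lia.
  by move=> j hj; apply: (gap_left hl hb) => //; lia.
exists i; split; first by lia.
by move=> j hj; case: (leP j i) => hji; [apply: no1 | apply: no2]; lia.
Qed.

Lemma part_eq z (i j : int) : Z z -> long z i -> long z j -> `|i - j| <= T%:Z ->
  periodic_part z i = periodic_part z j.
Proof.
move=> hz /(long_approx hz)[zh h] /(long_approx hz)[zh' h'] hij.
by rewrite (periodic_partE h) (periodic_partE h') (approx_uniq hij h h').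
Qed.

(** The branches of the definition of the code, with the marks around the
    position made explicit. *)
Lemma position_cases z (i : int) :
  [\/ exists a b : int, [/\ marked z a, marked z b, a <= i < b, b < a + T%:Z &
         forall j : int, a < j < b -> ~~ marked z j],
      long z i /\ exists a : int, [/\ marked z a, a <= i < a + (Lm + G)%N%:Z &
         forall j : int, a < j < a + T%:Z -> ~~ marked z j],
      long z i /\ exists b : int, [/\ marked z b, i < b <= i + G%:Z &
         forall j : int, b - T%:Z < j < b -> ~~ marked z j] |
      long z i /\ forall j : int, i - (Lm + G)%N%:Z < j <= i + G%:Z -> ~~ marked z j].
Proof.
case: (short_or_long z i) => [h|hl]; first by constructor 1.
case: (last_mark z (Lm + G) i) => [no1|[a [ha h1 h2]]]; last first.
  constructor 2; split=> //; exists a; split=> //; first by lia.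
  by apply: (gap_right hl ha) => //; lia.
case: (next_mark z G i) => [no2|[b [hb h3 h4]]]; last first.
  constructor 3; split=> //; exists b; split=> //.
  by apply: (gap_left hl hb) => //; lia.
constructor 4; split=> // j hj.
by case: (leP j i) => hji; [apply: no1 | apply: no2]; lia.
Qed.

(** Gaps of both kinds open with m. *)
Lemma code_mark z (a : int) (k : nat) : marked z a -> (k < Lm)%N ->
  code z (a + k%:Z) = nth alpha m k.
Proof.
move=> ha hk; case: (short_or_long z a) => [[a' [b [ha' hb hab hT no]]]|hl].
  have Ea : a' = a.
    apply/eqP; rewrite eq_le; apply/andP; split; first by lia.
    by rewrite leNgt; apply/negP => hlt; have := no a ltac:(lia); rewrite ha.
  subst a'; have hN := marked_sep ha hb ltac:(lia).
  rewrite (code_short ha hb _ hT no); last by lia.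
  have -> : `|(a + k%:Z - a)%R|%N = k by lia.
  by rewrite -(nth_take _ hk) short_m.
rewrite (code_left ha); try lia; last first.
  by apply: (gap_right hl ha) => //; lia.
have -> : `|(a + k%:Z - a)%R|%N = k by lia.
by rewrite nth_cat hk.
Qed.

Lemma m_head : nth alpha m 0 = alpha.
Proof. by have := walk_head alpha m_walk; rewrite nth_rcons Lm_gt0. Qed.

Lemma conn_head s t : nth alpha (conn s t) 0 = s.
Proof.
by have := walk_head alpha (conn_walk s t); rewrite nth_rcons size_conn G_gt0.
Qed.

Lemma code_mark0 z (a : int) : marked z a -> code z a = alpha.
Proof. by move=> ha; have := code_mark ha Lm_gt0; rewrite addr0 m_head. Qed.

(** The pieces of the code fit together because the connecting words are taken
    between the very vertices that the neighbouring pieces show. *)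
Lemma code_path z : Z z -> bipath e (code z).
Proof.
move=> hz i; case: (position_cases z i) => [[a [b [ha hb hab hT no]]]|
    [hl [a [ha hai no]]]|[hl [b [hb hib no]]]|[hl no]].
- have hN := marked_sep ha hb ltac:(lia).
  rewrite (code_short ha hb hab hT no).
  set w := window _ _ _; set L := `|b - a|%N.
  have sw : size (short L w) = L by rewrite size_short // /L; lia.
  have := walk_edge alpha (short_walk L w) (i := `|i - a|%N); rewrite sw nth_rcons sw.
  move=> /(_ ltac:(rewrite /L; lia)).
  case: (eqVneq (i + 1) b) => [Eb|nb].
    have -> : (`|i - a|%N.+1 < L)%N = false by rewrite /L; lia.
    have -> : `|i - a|%N.+1 = L by rewrite /L; lia.
    by rewrite eqxx Eb (code_mark0 hb).
  have -> : (`|i - a|%N.+1 < L)%N by rewrite /L; lia.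
  rewrite (code_short ha hb _ hT no); last by lia.
  by have -> : `|(i + 1 - a)%R|%N = `|i - a|%N.+1 by lia.
- rewrite (code_left ha) //; try lia.
  set s := periodic_part z i _.
  have hw : walk e alpha (m ++ conn alpha s) s by apply: walk_cat m_walk (conn_walk _ _).
  have sw : size (m ++ conn alpha s) = (Lm + G)%N by rewrite size_cat size_conn.
  have := walk_edge alpha hw (i := `|i - a|%N); rewrite sw nth_rcons sw.
  move=> /(_ ltac:(lia)).
  have hl1 : long z (i + 1).
    apply/(long_same (i := i)) => //; first by lia.
    by move=> j hj; apply: no; lia.
  have Epp : periodic_part z (i + 1) = periodic_part z i.
    by apply: part_eq => //; lia.
  case: (eqVneq (i + 1) (a + (Lm + G)%N%:Z)) => [Eb|nb].
    have -> : (`|i - a|%N.+1 < Lm + G)%N = false by lia.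
    have -> : `|i - a|%N.+1 = (Lm + G)%N by lia.
    rewrite eqxx (code_mid hl1) ?Epp ?Eb //.
    by move=> j hj; apply: no; lia.
  have -> : (`|i - a|%N.+1 < Lm + G)%N by lia.
  rewrite (code_left ha) //; try lia.
  by rewrite Epp; have -> : `|(i + 1 - a)%R|%N = `|i - a|%N.+1 by lia.
- rewrite (code_right hb) //; try lia.
  set s := periodic_part z i _.
  have := walk_edge alpha (conn_walk s alpha) (i := `|(i - (b - G%:Z))%R|%N).
  rewrite size_conn nth_rcons size_conn => /(_ ltac:(lia)).
  case: (eqVneq (i + 1) b) => [Eb|nb].
    have -> : (`|(i - (b - G%:Z))%R|%N.+1 < G)%N = false by lia.
    have -> : `|(i - (b - G%:Z))%R|%N.+1 = G by lia.
    by rewrite eqxx Eb (code_mark0 hb).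
  have hl1 : long z (i + 1).
    apply/(long_same (i := i)) => //; first by lia.
    by move=> j hj; apply: no; lia.
  have Epp : periodic_part z (i + 1) = periodic_part z i.
    by apply: part_eq => //; lia.
  have -> : (`|(i - (b - G%:Z))%R|%N.+1 < G)%N by lia.
  rewrite (code_right hb) //; try lia.
  by rewrite Epp; have -> : `|(i + 1 - (b - G%:Z))%R|%N = `|(i - (b - G%:Z))%R|%N.+1 by lia.
- have hl1 : long z (i + 1).
    apply/(long_same (i := i)) => //; first by lia.
    by move=> j hj; apply: no; lia.
  have Epp : periodic_part z (i + 1) = periodic_part z i.
    by apply: part_eq => //; lia.
  have [zh hzh] := long_approx hz hl.
  have hedge : e (periodic_part z i i) (periodic_part z i (i + 1)).
    by rewrite (periodic_partE hzh); apply: theta_path; exact: approx_per hzh.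
  rewrite (code_mid hl no).
  case: (boolP (marked z (i + 1 + G%:Z))) => [hb|nb].
    rewrite (code_right hb) //; try lia; last first.
      by apply: (gap_left hl1 hb) => [|j hj]; [lia | apply: no; lia].
    have -> : i + 1 + G%:Z - G%:Z = i + 1 by lia.
    by rewrite subrr absz0 conn_head Epp.
  rewrite (code_mid hl1) ?Epp // => j hj.
  by case: (eqVneq j (i + 1 + G%:Z)) => [->//|nj]; apply: no; lia.
Qed.

Lemma periodic_part_sh z (i j : int) :
  periodic_part (shiftZ z) i j = periodic_part z (i + 1) (j + 1).
Proof.
have shP zh : approx z (i + 1) zh -> approx (shiftZ z) i (shiftZ zh).
  move=> [h1 [p [h2 h3]] h4]; split; first exact: Z_shift.
    by exists p; split=> //; exact: period_shift.
  by move=> k hk; apply: h4; lia.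
case: (pselect (exists zh, approx z (i + 1) zh)) => [[zh h]|no].
  rewrite (periodic_partE h) (periodic_partE (shP _ h)) theta_sh //.
  exact: approx_per h.
have no' : ~ exists zh, approx (shiftZ z) i zh.
  move=> [zh [h1 [p [h2 h3]] h4]]; apply: no; exists (fun k => zh (k - 1)).
  split; first exact: Z_shift.
    by exists p; split=> //; exact: period_shift.
  by move=> k hk; rewrite h4 /shiftZ ?subrK //; lia.
by rewrite /periodic_part /point_of; case: pselect => // _; case: pselect.
Qed.

Lemma code_sh z : code (shiftZ z) = shiftZ (code z).
Proof.
apply/funext => i; rewrite /shiftZ -/(shiftZ z) /code.
have hmk (j : int) : marked (shiftZ z) j = marked z (j + 1) := marked_shift z j 1.
rewrite (before_ext (P' := marked z) (i' := i + 1)); last first.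
  by move=> k _; rewrite hmk; congr (marked z); lia.
rewrite (after_ext (P := marked (shiftZ z)) (P' := marked z) (i' := i + 1)); last first.
  by move=> k _; rewrite hmk; congr (marked z); lia.
have hw k L : window (shiftZ z) (i - k%:Z) L = window z (i + 1 - k%:Z) L.
  by apply: eq_window => l _; rewrite /shiftZ; congr z; lia.
have hl (k : nat) : periodic_part (shiftZ z) i (i - k%:Z + (Lm + G)%N%:Z) =
    periodic_part z (i + 1) (i + 1 - k%:Z + (Lm + G)%N%:Z).
  by rewrite periodic_part_sh; congr (periodic_part z _ _); lia.
have hr (k : nat) : periodic_part (shiftZ z) i (i + k%:Z - G%:Z) =
    periodic_part z (i + 1) (i + 1 + k%:Z - G%:Z).
  by rewrite periodic_part_sh; congr (periodic_part z _ _); lia.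
by case: (before _ _ _) => [k|]; case: (after _ _ _) => [k'|];
  rewrite ?hw ?hl ?hr ?periodic_part_sh.
Qed.

Lemma code_local (z z' : int -> C) (i : int) :
  (forall j : int, `|j - i| <= (Q + R + T)%N%:Z -> z j = z' j) ->
  code z i = code z' i.
Proof.
move=> h; rewrite /code.
have hmk (j : int) : `|j - i| <= T%:Z -> marked z j = marked z' j.
  by move=> hj; apply: marked_local => k hk; apply: h; lia.
rewrite (before_ext (P' := marked z') (i' := i)); last by move=> k hk; apply: hmk; lia.
rewrite (after_ext (P := marked z) (P' := marked z') (i' := i)); last by move=> k hk; apply: hmk; lia.
have hpp : periodic_part z i = periodic_part z' i.
  rewrite /periodic_part; congr point_of; apply/funext => zh; apply/propext.
  by split=> -[h1 h2 h3]; split=> // j hj; rewrite h3 // h //; lia.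
have := beforeP (marked z') T i; have := afterP (marked z') T i; rewrite hpp.
case: (after _ _ _) => [k'|]; case: (before _ _ _) => [k|] //.
move=> [hk' _ _] [hk _ _]; case: ifP => // hkk; congr (nth _ (short _ _) _).
by apply: eq_window => l hl; apply: h; lia.
Qed.

Variables (n : nat) (u : seq B) (pad core : seq V) (lo hi : nat).
Variable (payload : nat -> seq C -> seq V).
Hypothesis n_gt0 : (0 < n)%N.
Hypothesis size_u : size u = n.
Hypothesis N_big2 : (Lm + G + n + n < N)%N.
Hypothesis m_def : m = pad ++ core ++ pad.
Hypothesis occ_lo : occurs lam n u m lo.
Hypothesis occ_hi : occurs lam n u m hi.
Hypothesis occ_range : forall j, occurs lam n u m j -> (lo <= j <= hi)%N.
Hypothesis hi_lo : (n + G <= hi - lo)%N.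
Hypothesis hi_core : (hi < size pad + size core)%N.
Hypothesis lo_pad : (size pad < lo + n)%N.
Hypothesis pad_big : (hi - lo + n + n + G <= size pad)%N.
Hypothesis short_def : forall L w, short L w = m ++ payload L w.
Hypothesis payload_rare : forall L w, ~~ infix u (map lam (pad ++ payload L w ++ pad)).
Hypothesis theta_rare : forall zh j, periodic_pt zh -> window (lam \o theta zh) j n <> u.
Hypothesis theta_inj : forall z z', periodic_pt z -> periodic_pt z' ->
  lam \o theta z = lam \o theta z' -> z = z'.
Hypothesis payload_inj : forall L z z' (a : int), (N <= L)%N -> Z z -> Z z' ->
  map lam (payload L (window z a L)) = map lam (payload L (window z' a L)) ->
  window z a L = window z' a L.

Let y z := lam \o code z.
Let D := (hi - lo)%N.

Lemma window_in_m z (a q : int) : marked z a -> a <= q -> q + n%:Z <= a + Lm%:Z ->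
  window (y z) q n = u <-> occurs lam n u m `|q - a|%N.
Proof.
move=> ha h1 h2.
rewrite (window_take_drop (t0 := lam alpha) (s := map lam m) (a := a)) ?size_map //.
  by rewrite /occurs; split=> /eqP.
move=> k hk; rewrite /y /= (code_mark ha) // -(nth_map alpha (lam alpha)) //.
Qed.

(** Neither blocks nor periodic parts contain u, so each occurrence meets a
    marker word or a connecting word. *)
Lemma rare_positions z (q : int) : Z z -> window (y z) q n = u ->
  [\/ exists a : int, [/\ marked z a, a <= q & occurs lam n u m `|q - a|%N],
      exists a : int, [/\ marked z a, a + Lm%:Z - n%:Z < q < a + (Lm + G)%N%:Z &
         forall j : int, a < j < a + T%:Z -> ~~ marked z j] |
      exists b : int, [/\ marked z b, b - G%:Z - n%:Z < q < b &
         forall j : int, b - T%:Z < j < b -> ~~ marked z j]].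
Proof.
move=> hz hu; case: (position_cases z q) => [[a [b [ha hb hab hT no]]]|
    [hl [a [ha hai no]]]|[hl [b [hb hib no]]]|[hl no]].
- case: (lerP (q + n%:Z) (a + Lm%:Z)) => hq.
    constructor 1; exists a; split=> //; first by lia.
    by apply/(window_in_m ha) => //; lia.
  exfalso; have hN := marked_sep ha hb ltac:(lia).
  set L := `|b - a|%N; set w := window z a L.
  have eL : L%:Z = b - a by rewrite /L; lia.
  have sL : size (short L w) = L by rewrite size_short // /L; lia.
  have sm : Lm = (size pad + (size core + size pad))%N by rewrite /Lm m_def !size_cat.
  pose x := pad ++ payload L w ++ pad.
  have sd : (Lm + size (payload L w) = L)%N by rewrite -[RHS]sL short_def size_cat.
  have hx k : (k < size x)%N ->
      code z (a + (size pad + size core)%N%:Z + k%:Z) = nth alpha x k.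
    rewrite /x !size_cat => hk.
    case: (ltnP k (size pad + size (payload L w))) => hkL.
      rewrite (code_short ha hb _ hT no); last by lia.
      rewrite -/L -/w short_def m_def -!catA catA nth_cat size_cat.
      have -> : (`|(a + (size pad + size core)%N%:Z + k%:Z - a)%R|%N = (size pad + size core) + k)%N by lia.
      rewrite ltnNge leq_addr /= addKn [in RHS]catA [RHS]nth_cat.
      by rewrite size_cat hkL.
    have -> : a + (size pad + size core)%N%:Z + k%:Z = b + (k - (size pad + size (payload L w)))%N%:Z.
      by lia.
    rewrite (code_mark hb); last by lia.
    rewrite catA [RHS]nth_cat size_cat ltnNge hkL /= m_def nth_cat.
    by have -> : (k - (size pad + size (payload L w)) < size pad)%N by lia.
  have /negP := payload_rare L w; apply; rewrite -/x -hu.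
  have hm : forall k : nat, (k < size (map lam x))%N ->
     y z (a + (size pad + size core)%N%:Z + k%:Z) = nth (lam alpha) (map lam x) k.
    by move=> k; rewrite size_map => hk; rewrite /y /= hx // (nth_map alpha).
  rewrite (window_take_drop hm); first exact: infix_take_drop.
    by lia.
  by rewrite size_map /x !size_cat; lia.
- case: (lerP (q + n%:Z) (a + Lm%:Z)) => hq.
    constructor 1; exists a; split=> //; first by lia.
    by apply/(window_in_m ha) => //; lia.
  by constructor 2; exists a; split=> //; lia.
- by constructor 3; exists b; split=> //; lia.
- case: (next_mark z (G + n).-1 q) => [no2|[b [hb h1 h2]]]; last first.
    constructor 3; exists b; split=> //; first by lia.
    by apply: (gap_left hl hb) => //; lia.
  exfalso; have [zh hzh] := long_approx hz hl.
  apply: (theta_rare (zh := zh) (j := q) (approx_per hzh)); rewrite -hu; apply: eq_window => k hk.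
  have hlk : long z (q + k%:Z).
    apply/(long_same (i := q)) => //; first by lia.
    by move=> j hj; apply: no2; lia.
  rewrite /y /= code_mid //.
    by rewrite -(part_eq hz hl hlk) ?(periodic_partE hzh) //; lia.
  by move=> j hj; case: (leP j q) => hjq; [apply: no | apply: no2]; lia.
Qed.

(** Two occurrences of u at the largest possible distance inside a marker word
    occur together only there: a transition is too short to meet both. *)
Lemma mark_decode z (a : int) : Z z ->
  marked z a <-> window (y z) (a + lo%:Z) n = u /\ window (y z) (a + hi%:Z) n = u.
Proof.
move=> hz; have sm : Lm = (size pad + (size core + size pad))%N by rewrite /Lm m_def !size_cat.
have h1 := occurs_leq n_gt0 size_u occ_lo; have h2 := occurs_leq n_gt0 size_u occ_hi.
split=> [ha|[hlo hhi]].
  split; apply/(window_in_m ha); rewrite -/Lm in h1 h2 *; try lia.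
    by have -> : `|(a + lo%:Z - a)%R|%N = lo by lia.
  by have -> : `|(a + hi%:Z - a)%R|%N = hi by lia.
have hD : (D <= Lm)%N by rewrite /D /Lm; lia.
case: (rare_positions hz hlo) => [[b [hb b1 b2]]|[b [hb b1 b2]]|[b [hb b1 b2]]].
- have r1 := occ_range b2.
  case: (rare_positions hz hhi) => [[c [hc c1 c2]]|[c [hc c1 c2]]|[c [hc c1 c2]]].
  + have r2 := occ_range c2.
    have Ecb : c = b.
      case: (ltrgtP b c) => // hbc.
        by have := marked_sep hb hc hbc; rewrite /D /Lm in hD *; lia.
      by have := marked_sep hc hb hbc; rewrite /D /Lm in hD *; lia.
    by subst c; have -> : a = b by lia.
  + have Ecb : c = b.
      case: (ltrgtP b c) => // hbc.
        by have := marked_sep hb hc hbc; rewrite /D /Lm in hD *; lia.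
      by have := marked_sep hc hb hbc; rewrite /D /Lm in hD *; lia.
    by subst c; exfalso; rewrite /D in hD; lia.
  + exfalso; case: (ltP b c) => hbc.
      by have := marked_sep hb hc hbc; rewrite /D /Lm in hD *; lia.
    by lia.
- exfalso.
  case: (rare_positions hz hhi) => [[c [hc c1 c2]]|[c [hc c1 c2]]|[c [hc c1 c2]]].
  + have r2 := occ_range c2; have hcb : b < c by lia.
    by have := marked_sep hb hc hcb; have := b2 c; rewrite hc; lia.
  + case: (ltrgtP b c) => hbc; last by lia.
      by have := b2 c; rewrite hc; lia.
    by have := c2 b; rewrite hb; lia.
  + have hbc : b < c by lia.
    by have := b2 c; rewrite hc; lia.
- exfalso.
  case: (rare_positions hz hhi) => [[c [hc c1 c2]]|[c [hc c1 c2]]|[c [hc c1 c2]]].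
  + have r2 := occ_range c2.
    case: (ltrgtP b c) => hbc; last by lia.
      by have := marked_sep hb hc hbc; lia.
    by have := b2 c; rewrite hc; lia.
  + case: (ltrgtP b c) => hbc; last by lia.
      by have := marked_sep hb hc hbc; lia.
    by have := b2 c; rewrite hc; lia.
  + case: (ltrgtP b c) => hbc; last by lia.
      by have := c2 b; rewrite hb; lia.
    by lia.
Qed.

(** Two points of periods less than N coincide once they agree on N * N
    positions; a long gap has so many free of marker and connecting words. *)
Lemma long_stretch z (i : int) : long z i ->
  exists j0 : int, forall j : int, j0 <= j < j0 + (N * N)%N%:Z ->
    [/\ long z j, `|i - j| <= T%:Z &
        forall k : int, j - (Lm + G)%N%:Z < k <= j + G%:Z -> ~~ marked z k].
Proof.
move=> hl.
case: (last_mark z (Lm + G) i) => [no1|[a [ha h1 h2]]]; last first.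
  have no := gap_right hl ha ltac:(lia) h2.
  exists (a + (Lm + G)%N%:Z) => j hj; split; last by move=> k hk; apply: no; lia.
    apply/(long_same (i := i)) => //; first by lia.
    by move=> k hk; apply: no; lia.
  by lia.
case: (next_mark z (N * N + G) i) => [no2|[b [hb h3 h4]]]; last first.
  have no := gap_left hl hb ltac:(lia) h4.
  exists (b - (N * N + G)%N%:Z) => j hj; split; last by move=> k hk; apply: no; lia.
    case: (leP i j) => hij.
      by apply/(long_same (i := i)) => // k hk; apply: no; lia.
    apply/(long_same (i := j) (k := i)) => //; first by lia.
    by move=> k hk; apply: no; lia.
  by lia.
exists i => j hj; split.
- apply/(long_same (i := i)) => //; first by lia.
  by move=> k hk; apply: no2; lia.
- by lia.
by move=> k hk; case: (leP k i) => hki; [apply: no1 | apply: no2]; lia.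
Qed.

(** Equal labels give equal marks.  In short gaps the data words then give the
    letters; in long gaps the periodic parts agree on N * N positions, hence
    everywhere, and theta is injective on labels. *)
Lemma code_inj z z' : Z z -> Z z' -> y z = y z' -> z = z'.
Proof.
move=> hz hz' E.
have Emk a : marked z a = marked z' a.
  by apply/idP/idP => /mark_decode h; apply/mark_decode => //; move: (h ltac:(done)); rewrite E.
apply/funext => i.
case: (short_or_long z i) => [[a [b [ha hb hab hT no]]]|hl].
  have hN := marked_sep ha hb ltac:(lia).
  set L := `|b - a|%N; have eL : L%:Z = b - a by rewrite /L; lia.
  have ha' : marked z' a by rewrite -Emk.
  have hb' : marked z' b by rewrite -Emk.
  have no' j : a < j < b -> ~~ marked z' j by rewrite -Emk; exact: no.
  have sL w : size (short L w) = L by rewrite size_short //; lia.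
  have ES : map lam (short L (window z a L)) = map lam (short L (window z' a L)).
    apply: (@eq_from_nth _ (lam alpha)); rewrite !size_map !sL // => k hk.
    rewrite !(nth_map alpha) ?sL //.
    have := congr1 (fun f => f (a + k%:Z)) E; rewrite /y /=.
    rewrite (code_short ha hb _ hT no) ?(code_short ha' hb' _ hT no'); try lia.
    rewrite -/L; have -> : `|(a + k%:Z - a)%R|%N = k by lia.
    by [].
  move: ES; rewrite !short_def !map_cat => /eqP; rewrite eqseq_cat // => /andP[_ /eqP ED].
  have hNL : (N <= L)%N by lia.
  have /window_eq EW := payload_inj hNL hz hz' ED.
  by have := EW `|i - a|%N ltac:(lia); have -> : a + `|i - a|%N%:Z = i by lia.
have hl' : long z' i by move=> a b; rewrite -!Emk; exact: hl.
have [zh hzh] := long_approx hz hl; have [zh' hzh'] := long_approx hz' hl'.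
have [j0 hj0] := long_stretch hl.
suff Ezh : zh = zh'.
  have [_ _ h] := hzh; have [_ _ h'] := hzh'.
  by rewrite -h ?subrr -?h' ?subrr ?Ezh //; lia.
apply: theta_inj; [exact: approx_per hzh | exact: approx_per hzh' |].
have th_period w p : periodic_pt w -> period p w -> period p (theta w).
  move=> hw hp; apply/iter_sh_period.
  have sh_per k : periodic_pt (iter k (@shiftZ C) w).
    elim: k => //= k [IH1 [q [q0 hq]]]; split; first exact: Z_shift.
    by exists q; split=> //; exact: period_shift.
  have it k : theta (iter k (@shiftZ C) w) = iter k (@shiftZ V) (theta w).
    by elim: k => //= k <-; rewrite theta_sh.
  by rewrite -it; congr theta; apply/iter_sh_period.
have [_ [p [/andP[p0 pN] hp]] _] := hzh; have [_ [p' [/andP[p0' pN'] hp']] _] := hzh'.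
apply: (period_eq (a := j0) p0 p0').
- by apply: period_map; apply: th_period => //; exact: approx_per hzh.
- by apply: period_map; apply: th_period => //; exact: approx_per hzh'.
move=> k hk.
have hNN : (p * p' <= N * N)%N by apply: leq_mul; exact: ltnW.
have [h1 h2 h3] := hj0 (j0 + k%:Z) ltac:(lia).
have h1' : long z' (j0 + k%:Z) by move=> a b; rewrite -!Emk; exact: h1.
have h3' j : j0 + k%:Z - (Lm + G)%N%:Z < j <= j0 + k%:Z + G%:Z -> ~~ marked z' j.
  by rewrite -Emk; exact: h3.
have := congr1 (fun f => f (j0 + k%:Z)) E; rewrite /y /= (code_mid h1 h3) (code_mid h1' h3').
by rewrite -(part_eq hz hl h1 h2) -(part_eq hz' hl' h1' h2) (periodic_partE hzh) (periodic_partE hzh').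
Qed.

End Code.

(** * Embedding into a labelled graph *)

Local Close Scope ring_scope.
Lemma encode_words (C : finType) (Z : (int -> C) -> Prop) L r q :
  #|words Z L| <= q.+1 ^ r ->
  exists f : seq C -> seq 'I_q.+1, (forall w, size (f w) = r) /\
    forall z z' (a : int), Z z -> Z z' -> f (window z a L) = f (window z' a L) ->
      window z a L = window z' a L.
Proof.
move=> h; pose t0 := [tuple of nseq r (ord0 : 'I_q.+1)].
have [|g [_ ginj]] := @card_leq_inj _ _ (words Z L) [set: r.-tuple 'I_q.+1] t0.
  by rewrite cardsT card_tuple card_ord.
exists (fun w => if insub w is Some t then tval (g t) else tval t0); split.
  by move=> w; case: (insub w) => [t|]; rewrite size_tuple.
move=> z z' a hz hz'.
have sw (x : int -> C) : size (window x a L) == L by rewrite size_window.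
have iE (x : int -> C) : insub (window x a L) = Some (Tuple (sw x)) :> option (L.-tuple C).
  exact: (insubT (fun w : seq C => size w == L) (sw x)).
have hw x : Z x -> Tuple (sw x) \in words Z L.
  by move=> hx; rewrite inE; apply/asboolP; exists x, a.
by rewrite !iE => /val_inj /(ginj _ _ (hw z hz) (hw z' hz')) /(congr1 val).
Qed.

Section GraphEmbedding.
Variables (V B C : finType) (e : rel V) (lam : V -> B).
Variables (G : nat) (conn : V -> V -> seq V) (alpha : V).
Hypothesis G_gt0 : 0 < G.
Hypothesis conn_walk : forall s t, walk e s (conn s t) t.
Hypothesis size_conn : forall s t, size (conn s t) = G.
Variable (Z : (int -> C) -> Prop).
Hypothesis Z_ex : exists z, Z z.
Hypothesis Z_shift : forall (j : int) z, Z z -> Z (fun i => z (i + j)%R).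
Hypothesis Z_closed : forall x, (forall m : nat, exists z, Z z /\
  forall i : int, (`|i| <= m%:Z)%R -> z i = x i) -> Z x.

Lemma long_path s n : exists p, path e s p /\ size p = n.
Proof.
elim: n s => [|n IH] s; first by exists [::].
have [l El] := conn_cons G_gt0 conn_walk size_conn s alpha.
have := conn_walk s alpha; rewrite El /= => /andP[_].
case: l {El} => [|x l] /= /andP[hx _].
  by have [p [hp sp]] := IH alpha; exists (alpha :: p); rewrite /= hx hp sp.
by have [p [hp sp]] := IH x; exists (x :: p); rewrite /= hx hp sp.
Qed.

Variable k : nat.
Hypothesis k_gt0 : 0 < k.
Let K := G + G + k.-1.
Hypothesis more_labels : #|words Z K| + 3 <= #|labels e lam k|.
Hypothesis small : forall n, 0 < n -> exists g : (int -> C) -> (int -> B),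
  (forall z, Z z -> exact_period z n -> exact_period (g z) n /\
     exists x, [/\ bipath e x, period n x & lam \o x = g z]) /\
  (forall z z', Z z -> exact_period z n -> Z z' -> exact_period z' n -> g z = g z' -> z = z').

(** The constants are chosen in this order: the blocks; theta and its bound n0;
    the word u, hence the marker word; N, from which on words fit into data
    words; and T, beyond which a gap has room for the comparison of periodic
    parts. *)
Theorem graph_embedding : exists (psi : (int -> C) -> (int -> V)) (Q : nat),
  [/\ forall z, Z z -> bipath e (psi z),
      forall z, psi (shiftZ z) = shiftZ (psi z),
      forall (z z' : int -> C) (i : int),
        (forall j : int, (`|j - i| <= Q%:Z)%R -> z j = z' j) -> psi z i = psi z' i &
      forall z z', Z z -> Z z' -> lam \o psi z = lam \o psi z' -> z = z'].
Proof.
have K_gt0 : 0 < K by rewrite /K; lia.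
pose q := #|words Z K|.+1.
have d0 : k.-tuple B := [tuple of nseq k (lam alpha)].
have [|io [ioP ioinj]] := @card_leq_inj _ _ [set: 'I_q] (labels e lam k) d0.
  by rewrite cardsT card_ord /q; lia.
have [p0 [hp0 sp0]] := long_path alpha k.
have st0 : size (map lam (alpha :: p0)) == k.+1 by rewrite size_map /= sp0.
have ht0 : Tuple st0 \in labels e lam k.+1.
  by apply/labelsP => //; exists alpha, p0.
pose blk (b : option 'I_q) : seq V := if b is Some i then block e lam conn alpha (io i)
  else block e lam conn alpha (Tuple st0).
have blkS i := blockP alpha G_gt0 conn_walk size_conn k_gt0 (ioP i (in_setT i)).
have [bN1 bN2 _] := blockP alpha G_gt0 conn_walk size_conn (ltn0Sn k) ht0.
have blk_walk b : walk e alpha (blk b) alpha.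
  by case: b => [i|] //=; have [] := blkS i.
have size_blk i : size (blk (Some i)) = K by have [] := blkS i.
have size_blk0 : size (blk None) = K.+1 by rewrite /= bN2 /K; lia.
have blk_inj : injective (fun i => map lam (blk (Some i))).
  move=> i j /(congr1 (fun s => take k (drop G s))) /=.
  have [_ _ ->] := blkS i; have [_ _ ->] := blkS j => /val_inj.
  by apply: ioinj; rewrite in_setT.
have Z_sh z : Z z -> Z (shiftZ z) by exact: Z_shift.
have [n0 [theta [th1 th2]]] :=
  periodic_code K_gt0 blk_walk size_blk size_blk0 blk_inj Z_ex Z_sh small.
have per_exact_period z : periodic_pt Z z -> Z z /\ exists p, exact_period z p.
  by move=> [hz [p [p_gt0 hp]]]; split=> //; have [r []] := period_exact_period p_gt0 hp; exists r.
have [n [u [n_gt0 hu u_rare u_per]]] : exists n (u : n.-tuple B), [/\ 0 < n,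
    u \in labels e lam n, forall bs, ~~ infix u (map lam (flatten (map blk bs))) &
    forall (y : int -> B) d j, 0 < d < n0 -> period d y -> window y j n <> u].
  apply: (rare_word alpha G_gt0 conn_walk size_conn (k := k) (K := K) (K' := K.+1)) => //.
  - by case=> [i|]; rewrite ?size_blk ?size_blk0.
  - by case=> [i|]; rewrite ?size_blk ?size_blk0.
  - by rewrite card_option.
  - by rewrite card_option card_ord /q; lia.
(* Below n0 the period excludes u, from n0 on the blocks do. *)
have theta_rare zh j : periodic_pt Z zh -> window (lam \o theta zh) j n <> u.
  move=> /per_exact_period[hz [p hl]]; have [_ _ hl' hb] := th1 zh p hz hl.
  case: (ltnP p n0) => hp.
    by apply: (u_per _ p); [have [-> _ _] := hl | have [_ ? _] := hl'].
  move=> E; have [bs] := hb hp j n; rewrite E.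
  by apply/negP; exact: u_rare.
have size_u : size u = n by rewrite size_tuple.
have blk_gt0 : 0 < size (blk (Some ord0)) by rewrite size_blk.
have hu' : tval u \in [seq val t | t in labels e lam n] by apply: map_f; rewrite mem_enum.
have := marker_word G_gt0 conn_walk size_conn blk_walk blk_gt0 n_gt0 size_u u_rare hu'.
move=> [ps [core [lo [hi]]]]; set pad := flatten _; set m := pad ++ core ++ pad.
move=> [[m_walk occ_lo occ_hi occ_range] [hi_lo hi_core lo_pad pad_big]].
set Lm := size m.
have [n1 hn1] := room_words K_gt0 Z_ex 1 Lm.
pose N := n1 + Lm + G + n + n + 1.
have enc_ex L : exists f : seq C -> seq 'I_q, N <= L ->
   (forall w, size (f w) = room K (L - Lm)) /\
    forall z z' (a : int), Z z -> Z z' -> f (window z a L) = f (window z' a L) ->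
      window z a L = window z' a L.
  case: (leqP N L) => [hL|]; last by exists (fun _ => [::]).
  have [h1 _] := hn1 L ltac:(rewrite /N in hL; lia).
  by rewrite mul1n in h1; have [f hf] := encode_words h1; exists f.
have [enc encP] := choice enc_ex.
pose payload L w := data K blk (L - Lm) (enc L w).
pose short L w := m ++ payload L w.
pose T := N + N + N * N + Lm + G + G + 1.
have [marked [Q [marked_shift marked_local marked_sep marked_none]]] :=
  marker_lemma Z_shift Z_closed (N + (N * N + T)) (ltac:(rewrite /N; lia) : 0 < N).
have Lm_gt0 : 0 < Lm by rewrite /Lm /m !size_cat; lia.
have size_short L w : N <= L -> size (short L w) = L.
  move=> hL; have [_ h2] := hn1 L ltac:(rewrite /N in hL; lia).
  have [h3 _] := encP L hL.
  by rewrite size_cat (size_data_room K_gt0 size_blk size_blk0) ?h3 // /Lm; lia.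
have short_walk L w : walk e alpha (short L w) alpha.
  by apply: walk_cat m_walk _; exact: data_walk.
have short_m L w : take Lm (short L w) = m by rewrite take_size_cat.
have theta_path z : periodic_pt Z z -> bipath e (theta z).
  by move=> /per_exact_period[hz [p hl]]; have [] := th1 z p hz hl.
have theta_sh z : periodic_pt Z z -> theta (shiftZ z) = shiftZ (theta z).
  by move=> /per_exact_period[hz [p hl]]; have [] := th1 z p hz hl.
have theta_inj z z' : periodic_pt Z z -> periodic_pt Z z' -> lam \o theta z = lam \o theta z' -> z = z'.
  by move=> /per_exact_period[hz [p hl]] /per_exact_period[hz' [p' hl']]; exact: th2 hz hl hz' hl'.
have payload_rare L w : ~~ infix u (map lam (pad ++ payload L w ++ pad)).
  suff -> : pad ++ payload L w ++ pad =
      flatten (map blk (ps ++ data_names K (L - Lm) (enc L w) ++ ps)) by [].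
  by rewrite /payload /data /pad -!flatten_cat -!map_cat.
have payload_inj L z z' (a : int) : N <= L -> Z z -> Z z' ->
    map lam (payload L (window z a L)) = map lam (payload L (window z' a L)) ->
    window z a L = window z' a L.
  move=> hL hz hz' h; have [h3 h4] := encP L hL; apply: h4 => //.
  by apply: (data_inj size_blk blk_inj _ h); rewrite !h3.
have N_big : Lm + G < N by rewrite /N; lia.
have T_big : N + N + N * N + Lm + G + G < T by rewrite /T; lia.
have N_big2 : Lm + G + n + n < N by rewrite /N; lia.
exists (code G conn alpha Z m N T short marked theta), (Q + (N * N + T) + T).
split.
- by move=> z; exact: (code_path G_gt0 conn_walk size_conn Lm_gt0 m_walk N_big T_big
    size_short short_walk short_m marked_sep marked_none theta_path).
- exact: (code_sh conn G_gt0 Z_shift short Lm_gt0 m_walk N_big T_big marked_shift theta_sh).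
- by move=> z z' i; exact: (code_local conn G_gt0 Z short Lm_gt0 m_walk N_big T_big marked_local theta).
- by move=> z z'; exact: (code_inj G_gt0 Z_shift Lm_gt0 m_walk N_big T_big size_short
    short_m marked_sep marked_none theta_sh n_gt0 size_u N_big2 erefl occ_lo occ_hi occ_range
    hi_lo hi_core lo_pad pad_big (fun _ _ => erefl) payload_rare theta_rare theta_inj payload_inj).
Qed.

End GraphEmbedding.

(** * Topology of full shifts *)

From mathcomp Require Import all_classical all_reals all_analysis.
Import numFieldNormedType.Exports.

Local Open Scope classical_set_scope.
Local Open Scope ring_scope.
Section Topology.
Variable A : finType.

Definition cylinder (x : fullshift A) (m : nat) : set (fullshift A) :=
  [set y | forall i : int, `|i| <= m%:Z -> y i = x i].

Lemma nbhs_cylinder (x : fullshift A) m : nbhs x (cylinder x m).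
Proof.
have coord (i : int) : nbhs x [set y : fullshift A | y i = x i].
  have /= := @proj_continuous int (fun=> discrete_topology A) i x.
  move=> /(_ [set x i]); apply; exact: discrete_set1.
elim: m => [|m IH].
  apply: filterS (coord 0) => y /= h i hi.
  by have -> : i = 0 by lia.
apply: filterS (filterI IH (filterI (coord m.+1%:Z) (coord (- m.+1%:Z)))).
move=> y [/= h1 [h2 h3]] i hi.
case: (eqVneq i m.+1%:Z) => [->//|n1]; case: (eqVneq i (- m.+1%:Z)) => [->//|n2].
by apply: h1; lia.
Qed.

(** The filter of the sets that contain a cylinder around x converges to x
    coordinatewise, hence in the product topology. *)
Lemma nbhs_cylinderP (x : fullshift A) (U : set (fullshift A)) :
  nbhs x U -> exists m, cylinder x m `<=` U.
Proof.
pose F : set_system (fullshift A) := [set U | exists m, cylinder x m `<=` U].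
have FF : Filter F.
  split; first by exists 0%N.
    move=> P Q [m hm] [n hn]; exists (maxn m n) => y hy; split.
      by apply: hm => i hi; apply: hy; lia.
    by apply: hn => i hi; apply: hy; lia.
  by move=> P Q PQ [m hm]; exists m; exact: subset_trans PQ.
suff : F --> x by apply.
apply/cvg_sup => i; apply/cvg_image.
  by rewrite eqEsubset; split=> v // _; exists (fun=> v).
move=> W /= /nbhs_singleton Wx.
exists [set y : fullshift A | W (y i)].
  by exists `|i|%N => y hy /=; rewrite hy //; lia.
rewrite eqEsubset; split=> [v [y hy <-]//|v Wv].
by exists (fun=> v).
Qed.

Lemma fullshift_compact : compact [set: fullshift A].
Proof.
have := @tychonoff int (fun=> discrete_topology A) (fun=> setT).
move=> h; have -> : [set: fullshift A] =
    [set f | forall i : int, [set: discrete_topology A] (f i)].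
  by rewrite eqEsubset; split.
apply: h => _; exact/finite_compact/(@finite_finset A).
Qed.

Lemma fullshift_hausdorff : hausdorff_space (fullshift A).
Proof.
apply: (@hausdorff_product int (fun=> discrete_topology A)) => i.
exact: discrete_hausdorff.
Qed.

Lemma closed_cylinder (S : set (fullshift A)) (x : fullshift A) : closed S ->
  (forall m : nat, exists z, S z /\ forall i : int, `|i| <= m%:Z -> z i = x i) -> S x.
Proof.
move=> cS h; apply: cS => U /nbhs_cylinderP[m hm].
by have [z [Sz hz]] := h m; exists z; split=> //; exact: hm.
Qed.

End Topology.

Section Maps.
Variables (A B : finType) (S : set (fullshift A)).

(** Curtis, Hedlund and Lyndon: continuity gives a window at each point, and
    compactness a window that serves all points. *)
Lemma uniform_window (f : fullshift A -> fullshift B) : closed S ->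
  {within S, continuous f} ->
  exists r : nat, forall x x', S x -> S x' ->
    (forall i : int, `|i| <= r%:Z -> x' i = x i) -> f x' 0 = f x 0.
Proof.
move=> cS /subspace_continuousP cf.
have compS : compact S.
  by apply: subclosed_compact cS (@fullshift_compact A) _.
have /compact_near_coveringP near := compS.
pose P (r : nat) (x : fullshift A) := S x -> forall x', S x' -> cylinder x r x' -> f x' 0 = f x 0.
have [r _ hr] : \forall r \near \oo, S `<=` P r.
  apply: (near nat \oo P) => x Sx.
  have : nbhs x [set y | S y -> f y 0 = f x 0].
    have h0 : nbhs x [set y | S y -> cylinder (f x) 0 (f y)].
      exact: (cf x Sx (cylinder (f x) 0) (nbhs_cylinder (f x) 0)).
    apply: (filterS _ h0) => y /= h Sy.
    by apply: h => //; lia.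
  move=> /nbhs_cylinderP[m hm].
  exists (cylinder x m, [set r | (m <= r)%N]) => /=.
    by split; [exact: nbhs_cylinder | exists m].
  move=> [y r] [/= hy hr] Sy x' Sx' hx'.
  rewrite (hm y) // (hm x') // => i hi.
  by rewrite hx' ?hy //; lia.
exists r => x x' Sx Sx' h; apply: (hr r _ x Sx Sx x' Sx' h) => /=.
exact: leqnn.
Qed.

Lemma local_continuous (f : fullshift A -> fullshift B) (Q : nat) :
  (forall (z z' : fullshift A) (i : int),
     (forall j : int, `|j - i| <= Q%:Z -> z j = z' j) -> f z i = f z' i) ->
  {within S, continuous f}.
Proof.
move=> h; apply/subspace_continuousP => x Sx U /nbhs_cylinderP[m hm].
suff : nbhs x [set y | S y -> U (f y)] by [].
apply: (filterS _ (nbhs_cylinder x (m + Q))) => y hy _.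
by apply: hm => i hi; apply: h => j hj; apply: hy; lia.
Qed.

Lemma closed_image (f : fullshift A -> fullshift B) : closed S ->
  {within S, continuous f} -> closed (f @` S).
Proof.
move=> cS cf; apply: compact_closed; first exact: fullshift_hausdorff.
apply: continuous_compact => //.
by apply: subclosed_compact cS (@fullshift_compact A) _.
Qed.

End Maps.

(** * Shift-invariant sets and sliding block codes *)

Section Shifts.
Variables (A : finType) (S : set (fullshift A)).
Hypothesis shS : @shift_map A @` S = S.

Lemma subshift_sh (x : fullshift A) : S x -> S (shiftZ x).
Proof. by move=> Sx; rewrite -shS; exists x. Qed.

Lemma subshift_unsh (x : fullshift A) : S (shiftZ x) -> S x.
Proof.
rewrite -{1}shS => -[y Sy E]; suff -> : x = y by [].
apply/funext => i; have := congr1 (fun f : int -> A => f (i - 1)) E.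
by rewrite /shift_map /shiftZ subrK => ->.
Qed.

Lemma subshift_translate (j : int) (x : fullshift A) : S x ->
  S (fun i => x (i + j) : discrete_topology A).
Proof.
have sh_add (k : int) (y : int -> A) :
    shiftZ (fun i => y (i + k)) = (fun i => y (i + (k + 1))).
  by apply/funext => i; rewrite /shiftZ; congr y; lia.
have hn (n : nat) (y : fullshift A) : S y -> S (fun i => y (i + n%:Z) : discrete_topology A).
  move=> Sy; elim: n => [|n IH].
    suff -> : (fun i : int => y (i + 0%:Z)) = y by [].
    by apply/funext => i; rewrite addr0.
  have := subshift_sh IH; rewrite sh_add.
  by have -> : n%:Z + 1 = n.+1%:Z by lia.
have hm (n : nat) (y : fullshift A) : S y -> S (fun i => y (i - n%:Z) : discrete_topology A).
  move=> Sy; elim: n => [|n IH].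
    suff -> : (fun i : int => y (i - 0%:Z)) = y by [].
    by apply/funext => i; rewrite subr0.
  apply: subshift_unsh; rewrite sh_add.
  by have -> : - n.+1%:Z + 1 = - n%:Z by lia.
move=> Sx; case: (lerP 0 j) => hj.
  by have := hn `|j|%N x Sx; rewrite gez0_abs.
have := hm `|j|%N x Sx.
by have -> : - `|j|%N%:Z = j by lia.
Qed.

Lemma sbc_shift (B : finType) (f : fullshift A -> fullshift B) (j : int) (x : fullshift A) :
  (forall x, S x -> f (shift_map x) = shift_map (f x)) -> S x ->
  f (fun i => x (i + j)) = (fun i => f x (i + j)).
Proof.
move=> fsh.
have sh_add (T : Type) (k : int) (y : int -> T) :
    shiftZ (fun i => y (i + k)) = (fun i => y (i + (k + 1))).
  by apply/funext => i; rewrite /shiftZ; congr y; lia.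
have hn (n : nat) (y : fullshift A) : S y -> f (fun i => y (i + n%:Z)) = (fun i => f y (i + n%:Z)).
  move=> Sy; elim: n => [|n IH].
    have -> : (fun i : int => y (i + 0%:Z)) = y by apply/funext => i; rewrite addr0.
    by apply/funext => i; rewrite addr0.
  have E : f (shiftZ (fun i => y (i + n%:Z))) = shiftZ (f (fun i => y (i + n%:Z))).
    exact: fsh (subshift_translate n%:Z Sy).
  rewrite IH !sh_add in E.
  by have <- : n%:Z + 1 = n.+1%:Z by lia.
move=> Sx; case: (lerP 0 j) => hj.
  by have := hn `|j|%N x Sx; rewrite gez0_abs.
have hS := subshift_translate j Sx.
have := hn `|j|%N _ hS.
have -> : (fun i : int => x (i + `|j|%N%:Z + j)) = x.
  by apply/funext => i; congr x; lia.
move=> E; apply/funext => i; have := congr1 (fun g : int -> B => g (i + j)) E.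
by rewrite /= => ->; congr (f _ _); lia.
Qed.

End Shifts.

Lemma exact_periodE (A : finType) (x : fullshift A) n : least_period x n <-> exact_period x n.
Proof.
split=> -[h1 h2 h3]; split=> //.
- exact/(@iter_sh_period A).
- by move=> m hm /(@iter_sh_period A); exact: h3.
- exact/(@iter_sh_period A).
- by move=> m hm h; apply: (h3 m hm); exact/(@iter_sh_period A).
Qed.

Lemma num_words_words (A : finType) (S : set (fullshift A)) n :
  #|words S n| = num_words S n.
Proof.
apply: eq_card => t; rewrite !inE; apply/asboolP/idP.
  move=> [z [j [Sz E]]]; rewrite inE; split; last by rewrite size_tuple.
  by exists z => //; exists j; rewrite size_tuple.
rewrite inE => -[[z Sz [j E]] _]; exists z, j; split=> //.
by rewrite size_tuple in E.
Qed.

(** * A shift of finite type as a graph *)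

Section WordGraph.
Variables (A B : finType) (X : set (fullshift A)) (F : seq (seq A)) (l' : nat).
Let l := l'.+1.
Hypothesis shX : @shift_map A @` X = X.
Hypothesis XF : X = [set x | forall w : seq A, w \in F -> ~ appears w x].
Hypothesis l_big : forall w, w \in F -> (size w <= l)%N.

(** The higher block presentation: X is the set of sequences spelled by the
    bi-infinite paths of this graph. *)
Definition vertex := {t : l.-tuple A | `[< language X (val t) >]}.
Definition edge : rel vertex :=
  fun s t => drop 1 (val (val s)) == take l' (val (val t)).
Definition letter (s : vertex) : A := thead (val s).
Definition spell (x : int -> vertex) : fullshift A := fun i => letter (x i).

Lemma size_vertex (s : vertex) : size (val (val s)) = l.
Proof. by rewrite size_tuple. Qed.

Lemma spell_window (x : int -> vertex) i : bipath edge x -> window (spell x) i l = val (val (x i)).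
Proof.
move=> hx; pose a0 := letter (x 0).
apply: (@eq_from_nth _ a0); rewrite size_window ?size_vertex // => k hk.
rewrite nth_window //.
elim: k i hk => [|k IH] i hk.
  by rewrite addr0 /spell /letter /thead (tnth_nth a0).
have -> : i + k.+1%:Z = (i + 1) + k%:Z by lia.
rewrite IH; last by lia.
have /eqP := hx i => E.
have := congr1 (fun s => nth a0 s k) E; rewrite nth_drop nth_take ?add1n //; lia.
Qed.

(** A forbidden word has length at most l, so its occurrence in the sequence would
    lie inside a single vertex, which is a word of the language. *)
Lemma spell_in (x : int -> vertex) : bipath edge x -> X (spell x).
Proof.
move=> hx; rewrite XF => w hw [i E].
have := valP (x i) => /asboolP[z Xz [j]]; rewrite size_vertex => Ez.
move: Xz; rewrite XF => /(_ w hw); apply; exists j.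
have hs := l_big hw.
have cut (y : int -> A) k : window y k (size w) = take (size w) (window y k l).
  by rewrite -(subnKC hs) window_cat take_size_cat ?size_window.
change (window z j (size w) = w); rewrite cut.
change (window z j l = val (val (x i))) in Ez; rewrite Ez -spell_window // -cut.
exact: E.
Qed.

Lemma vertex_exists (x : fullshift A) (i : int) : X x ->
  exists s : vertex, val (val s) = window x i l.
Proof.
move=> Xx; have sw : size (window x i l) == l by rewrite size_window.
have h : `[< language X (val (Tuple sw)) >].
  by apply/asboolP; exists x => //; exists i; rewrite (size_tuple (Tuple sw)).
by exists (Sub (Tuple sw) h).
Qed.

Lemma path_exists (x : fullshift A) : X x ->
  exists y : int -> vertex, [/\ bipath edge y, spell y = x &
    forall i, val (val (y i)) = window x i l].
Proof.
move=> Xx; have [y hy] := choice (fun i => vertex_exists i Xx).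
exists y; split=> //.
  move=> i; rewrite /edge !hy; apply/eqP.
  have -> : drop 1 (window x i l) = window x (i + 1) l'.
    by rewrite /l -[l'.+1]add1n window_cat drop_size_cat ?size_window.
  have -> // : take l' (window x (i + 1) l) = window x (i + 1) l'.
  by rewrite /l -[l'.+1]addn1 window_cat take_size_cat ?size_window.
apply/funext => i; rewrite /spell /letter /thead (tnth_nth (x 0)) hy nth_window //.
by rewrite addr0.
Qed.

Lemma bipath_walk (y : int -> vertex) i n : bipath edge y ->
  walk edge (y i) (window y i n) (y (i + n%:Z)).
Proof.
move=> hy; elim: n i => [|n IH] i.
  by rewrite addr0 /walk /=.
have -> : window y i n.+1 = [:: y i] ++ window y (i + 1) n.
  by rewrite -add1n window_cat /window /= addr0.
have -> : i + n.+1%:Z = (i + 1) + n%:Z by lia.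
by apply: walk_cat (IH _); rewrite /= eqxx hy.
Qed.

(** The windows of length l of a word s ++ v ++ t with size v = g form a path
    with l + g edges from s to t. *)
Lemma connections g : strongly_irreducible_gap X g ->
  exists conn : vertex -> vertex -> seq vertex,
    (forall s t, walk edge s (conn s t) t) /\ (forall s t, size (conn s t) = l + g)%N.
Proof.
move=> [_ hg].
have H (st : vertex * vertex) : exists c : seq vertex,
    walk edge st.1 c st.2 /\ size c = (l + g)%N.
  case: st => s t /=.
  have /asboolP hs := valP s; have /asboolP ht := valP t.
  have [v [_ sv] [x Xx [i E]]] := hg _ _ hs ht.
  have {}E : window x i (l + (g + l)) = val (val s) ++ v ++ val (val t).
    by rewrite -E !size_cat !size_vertex sv.
  have [y [hy _ yw]] := path_exists Xx.
  exists (window y i (l + g)); split; last by rewrite size_window.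
  have es : y i = s.
    apply/val_inj/val_inj; rewrite /= yw.
    have := congr1 (take l) E; rewrite window_cat !take_size_cat ?size_window ?size_vertex //.
  have et : y (i + (l + g)%N%:Z) = t.
    apply/val_inj/val_inj; rewrite /= yw.
    have := congr1 (drop (l + g)) E; rewrite addnA window_cat drop_size_cat ?size_window //.
    by rewrite catA drop_size_cat // size_cat size_vertex sv.
  by rewrite -{1}es -et; exact: bipath_walk.
have [c hc] := choice H.
exists (fun s t => c (s, t)); split=> s t.
  by have [] := hc (s, t).
by have [] := hc (s, t).
Qed.

Variables (Y : set (fullshift B)) (pi : fullshift A -> fullshift B) (r : nat).
Hypothesis pi_sh : forall x, X x -> pi (shift_map x) = shift_map (pi x).
Hypothesis pi_window : forall x x', X x -> X x' ->
    (forall i : int, `|i| <= r%:Z -> x' i = x i) -> pi x' 0 = pi x 0.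
Hypothesis r_l : (r + r < l)%N.

(** Reading the window of the code from its left end makes the code a labelling
    of the vertices. *)
Lemma label_exists : exists lam : vertex -> B, forall (y : int -> vertex) (i : int),
  bipath edge y -> lam (y i) = pi (spell y) (i + r%:Z).
Proof.
have at0 (x : fullshift A) (i : int) : X x -> pi x i = pi (fun k => x (k + i)) 0.
  by move=> Xx; rewrite (sbc_shift shX i pi_sh Xx) add0r.
have H (s : vertex) : exists b : B, forall (x : fullshift A) (i : int), X x ->
    window x i l = val (val s) -> pi x (i + r%:Z) = b.
  have /asboolP[z Xz [j E]] := valP s; exists (pi z (j + r%:Z)) => x i Xx Ex.
  rewrite (at0 x) // (at0 z) //; apply: pi_window;
    try by [exact: (subshift_translate shX _ Xz) | exact: (subshift_translate shX _ Xx)].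
  move=> k hk /=.
  have {}E : window x i l = window z j l by rewrite Ex -E size_vertex.
  have := window_eq E (k := `|(k + r%:Z)%R|%N) ltac:(lia).
  have -> : i + `|(k + r%:Z)%R|%N%:Z = k + (i + r%:Z) by lia.
  by have -> : j + `|(k + r%:Z)%R|%N%:Z = k + (j + r%:Z) by lia.
have [lam hlam] := choice H; exists lam => y i hy.
exact/esym/(hlam _ _ _ (spell_in hy) (spell_window i hy)).
Qed.

End WordGraph.

(** * Entropy *)

Section Fekete.
Variables (R : realType) (a : nat -> R).
Hypothesis a_ge0 : forall n, 0 <= a n.
Hypothesis a_sub : forall m n, a (m + n)%N <= a m + a n.

Lemma subadditive_mul m q : (0 < q)%N -> a (q * m)%N <= q%:R * a m.
Proof.
case: q => // q _; elim: q => [|q IH]; first by rewrite mul1n mul1r.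
rewrite mulSn; apply: le_trans (a_sub _ _) _.
by rewrite -[q.+2]add1n natrD mulrDl mul1r lerD2l.
Qed.

(** For a subadditive sequence this infimum is the limit of a n / n. *)
Definition growth : R := inf [set a n / n%:R | n in [set n | (0 < n)%N]].

Let growth_set := [set a n / n%:R | n in [set n | (0 < n)%N]].

Lemma growth_has_inf : has_inf growth_set.
Proof.
split; first by exists (a 1 / 1%:R), 1%N.
by exists 0 => _ [n _ <-]; rewrite divr_ge0.
Qed.

Lemma growth_le n : (0 < n)%N -> n%:R * growth <= a n.
Proof.
move=> n0; have n0' : 0 < n%:R :> R by rewrite ltr0n.
rewrite mulrC -ler_pdivlMr //; apply: ge_inf; last by exists n.
by have [_] := growth_has_inf.
Qed.

Lemma growth_ge0 : 0 <= growth.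
Proof.
apply: lb_le_inf; first by have [] := growth_has_inf.
by move=> _ [n _ <-]; rewrite divr_ge0.
Qed.

(** Fekete's lemma: with a m / m almost minimal and n = q * m + r, subadditivity
    gives a n <= q * a m + a r, where a r is bounded. *)
Lemma growth_lt (eps : R) : 0 < eps ->
  exists n0, forall n, (n0 <= n)%N -> a n <= n%:R * (growth + eps).
Proof.
move=> e0.
have e2 : 0 < eps / 2 by rewrite divr_gt0.
have [_ [m /= m0 <-] hm] := inf_adherent e2 growth_has_inf.
have m0' : 0 < m%:R :> R by rewrite ltr0n.
pose c := a 0%N + m%:R * a 1%N.
have ham : a m <= m%:R * (growth + eps / 2).
  by rewrite mulrC -ler_pdivrMr // ltW.
have c0 : 0 <= c by rewrite addr_ge0 // mulr_ge0.
exists ((Num.truncn (c / (eps / 2))).+1 + m)%N => n hn.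
have hc : c <= n%:R * (eps / 2).
  rewrite -ler_pdivrMr //; apply: le_trans (ltW (truncnS_gt _)) _.
  by rewrite ler_nat; apply: leq_trans (leq_addr _ _) hn.
have ar r : (r < m)%N -> a r <= c.
  case: r => [|r] hr; first by rewrite /c lerDl mulr_ge0.
  have := subadditive_mul 1 (ltn0Sn r); rewrite muln1 => h; apply: le_trans h _.
  apply: (@le_trans _ _ (m%:R * a 1%N)); last by rewrite lerDr.
  by rewrite ler_wpM2r // ler_nat ltnW.
have q0 : (0 < n %/ m)%N by rewrite divn_gt0 //; lia.
rewrite {1}(divn_eq n m); apply: le_trans (a_sub _ _) _.
rewrite [growth + eps](_ : _ = (growth + eps / 2) + eps / 2); last by lra.
rewrite mulrDr; apply: lerD; last exact: le_trans (ar _ (ltn_pmod _ m0)) hc.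
apply: le_trans (subadditive_mul m q0) _.
apply: (@le_trans _ _ ((n %/ m)%:R * (m%:R * (growth + eps / 2)))).
  by rewrite ler_wpM2l.
rewrite mulrA -natrM; apply: ler_wpM2r; last by rewrite ler_nat leq_trunc_div.
by rewrite addr_ge0 ?growth_ge0 // ltW.
Qed.

Lemma growth_cvg : (fun n => n%:R^-1 * a n) @ \oo --> growth.
Proof.
apply/cvgrPdist_le => eps e0; have [n0 h] := growth_lt e0.
exists n0.+1 => // n /= hn.
have n0' : 0 < n%:R :> R by rewrite ltr0n; lia.
have h1 := h n (ltnW hn); have h2 := growth_le (ltac:(lia) : (0 < n)%N).
have h3 : n%:R^-1 * a n <= growth + eps by rewrite mulrC ler_pdivrMr // mulrC.
have h4 : growth <= n%:R^-1 * a n by rewrite mulrC ler_pdivlMr // mulrC.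
by rewrite ler_norml; lra.
Qed.

End Fekete.

Section Entropy.
Variable R : realType.

Definition log_words (A : finType) (S : set (fullshift A)) (n : nat) : R :=
  ln (num_words S n)%:R.

Lemma num_words_gt0 (A : finType) (S : set (fullshift A)) n :
  (exists x, S x) -> (0 < num_words S n)%N.
Proof. by move=> h; rewrite -num_words_words; exact: card_words_gt0. Qed.

Lemma log_words_ge0 (A : finType) (S : set (fullshift A)) n :
  (exists x, S x) -> 0 <= log_words S n.
Proof. by move=> h; rewrite ln_ge0 // ler1n num_words_gt0. Qed.

Lemma log_words_add (A : finType) (S : set (fullshift A)) m n :
  (exists x, S x) -> log_words S (m + n) <= log_words S m + log_words S n.
Proof.
move=> h; have pos k : (num_words S k)%:R \is @Num.pos R.
  by rewrite posrE ltr0n num_words_gt0.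
rewrite -lnM // -natrM ler_ln //; last by rewrite posrE ltr0n muln_gt0 !num_words_gt0.
by rewrite ler_nat -!num_words_words card_words_add.
Qed.

Lemma entropy_growth (A : finType) (S : set (fullshift A)) :
  (exists x, S x) -> entropy R S = (growth (log_words S))%:E.
Proof.
move=> h; apply/cvg_lim => //.
have := growth_cvg (fun n => log_words_ge0 n h) (fun m n => log_words_add m n h).
move=> hc; have -> : (fun n : nat => ((n%:R^-1)%:E * lne (num_words S n)%:R%:E)%E) =
   EFin \o (fun n => n%:R^-1 * log_words S n).
  apply/funext => n; rewrite lne_EFin; first by rewrite -EFinM.
  by rewrite ltr0n num_words_gt0.
by apply: cvg_comp hc _.
Qed.

Lemma entropy_set0 (A : finType) (S : set (fullshift A)) :
  ~ (exists x, S x) -> entropy R S = -oo%E.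
Proof.
move=> h; apply/cvg_lim => //; apply: cvg_near_cst.
exists 1%N => // n hn; have n0 : (0 < n)%N := hn.
have E : num_words S n = 0%N.
  apply: eq_card0 => t; rewrite inE; apply/negbTE/negP => /asboolP.
  by move=> [[x Sx _] _]; apply: h; exists x.
by rewrite E le0_lneNy ?lexx // gt0_muleNy // lte_fin invr_gt0 ltr0n.
Qed.

(** Both entropies are limits of the normalized logarithms, so the numbers of
    words differ by an exponentially growing factor, which absorbs a constant
    shift of the length and a constant summand. *)
Lemma entropy_gap (C B : finType) (Z : set (fullshift C)) (Y : set (fullshift B)) :
  (exists z, Z z) -> (entropy R Z < entropy R Y)%E ->
  (exists y, Y y) /\
  forall c, exists k, (0 < k)%N /\ (num_words Z (k + c) + 3 <= num_words Y k)%N.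
Proof.
move=> hZ hent; case: (pselect (exists y, Y y)) => [hY|nY]; last first.
  by move: hent; rewrite (entropy_set0 nY) ltNge leNye.
split=> // c; move: hent; rewrite !entropy_growth // lte_fin.
set gZ := growth _; set gY := growth _ => hlt.
have aZ0 n := log_words_ge0 n hZ; have aZs m n := log_words_add m n hZ.
have aY0 n := log_words_ge0 n hY; have aYs m n := log_words_add m n hY.
pose eps := (gY - gZ) / 2; have e0 : 0 < eps by rewrite /eps; lra.
have [n0 hn0] := growth_lt aZ0 aZs e0; rewrite -/gZ in hn0.
pose h1 := gZ + eps; have h10 : 0 <= h1 by rewrite addr_ge0 ?growth_ge0 // ltW.
pose E := expR (c%:R * h1) + 3.
have E0 : 0 <= E by rewrite addr_ge0 // expR_ge0.
pose k := ((Num.truncn (E / eps)).+1 + n0.+1)%N.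
exists k; split; first by rewrite /k; lia.
have kE : E <= k%:R * eps.
  rewrite -ler_pdivrMr //; apply: le_trans (ltW (truncnS_gt _)) _.
  by rewrite ler_nat leq_addr.
have numE (T : finType) (S : set (fullshift T)) n : (exists x, S x) ->
    (num_words S n)%:R = expR (log_words S n) :> R.
  by move=> h; rewrite lnK // posrE ltr0n num_words_gt0.
rewrite -(ler_nat R) natrD !numE //.
have z1 : expR (log_words Z (k + c)) <= expR (k%:R * h1) * expR (c%:R * h1).
  by rewrite -expRD ler_expR -mulrDl -natrD; apply: hn0; rewrite /k; lia.
have y1 : expR (k%:R * h1) * expR (k%:R * eps) <= expR (log_words Y k).
  rewrite -expRD ler_expR -mulrDr.
  have -> : h1 + eps = gY by rewrite /h1 /eps; lra.
  by apply: growth_le => //; rewrite /k; lia.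
have k1 : 1 <= expR (k%:R * h1) by apply: le_trans (expR_ge1Dx _); rewrite lerDl mulr_ge0.
have k2 : E <= expR (k%:R * eps).
  by apply: le_trans kE _; apply: le_trans (expR_ge1Dx _); rewrite lerDr.
apply: le_trans y1; apply: (@le_trans _ _ (expR (k%:R * h1) * E)); last first.
  by rewrite ler_wpM2l // expR_ge0.
by rewrite /E mulrDr; apply: lerD => //; nra.
Qed.

End Entropy.

(** * The embedding theorem *)

Local Close Scope ring_scope.
Local Open Scope card_scope.

Lemma inj_card_le_fun {T U : Type} (A : set T) (B : set U) (g : T -> U) :
  (forall x, A x -> B (g x)) ->
  (forall x y, A x -> A y -> g x = g y -> x = y) -> A #<= B.
Proof.
move=> gB ginj; have /card_esym gA : g @` A #= A.
  by apply: inj_card_eq => x y /set_mem Ax /set_mem Ay; exact: ginj.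
apply: (card_le_trans (B := g @` A)); first by rewrite (card_le_eql gA).
by apply: subset_card_le => _ [x Ax <-]; exact: gB.
Qed.

Lemma card_le_inj_fun {T U : Type} (A : set T) (B : set U) (u0 : U) : A #<= B ->
  exists g : T -> U, (forall x, A x -> B (g x)) /\
    (forall x y, A x -> A y -> g x = g y -> x = y).
Proof.
move=> /card_leP[f].
pose g x := if pselect (A x) is left h then val (f (exist _ x (mem_set h))) else u0.
exists g; split=> [x Ax|x y Ax Ay]; rewrite /g.
  by case: pselect => // h; exact: set_mem (valP (f _)).
case: pselect => // hx; case: pselect => // hy /val_inj E.
by have /(congr1 val) := inj (mem_setT _) (mem_setT _) E.
Qed.

Lemma exact_period_code (A B : finType) (S : set (fullshift A)) (f : fullshift A -> fullshift B)
    (x : fullshift A) n :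
  @shift_map A @` S = S -> (forall x, S x -> f (shift_map x) = shift_map (f x)) ->
  (forall x y, S x -> S y -> f x = f y -> x = y) ->
  S x -> least_period x n -> least_period (f x) n.
Proof.
move=> shS fsh finj Sx [n0 hn hl].
have Si m : S (iter m (@shift_map A) x).
  by elim: m => //= m IH; rewrite -shS; exists (iter m (@shift_map A) x).
have fi m : f (iter m (@shift_map A) x) = iter m (@shift_map B) (f x).
  by elim: m => //= m IH; rewrite fsh // IH.
split=> // [|m hm]; first by rewrite -fi hn.
by rewrite -fi => E; apply: (hl m hm); exact: finj.
Qed.

Lemma exact_period_shift (T : Type) (x : int -> T) (j : int) n :
  exact_period x n -> exact_period (fun i => x (i + j)%R) n.
Proof.
move=> [n0 hn hl]; split=> // [|m hm h]; first exact: period_shift.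
apply: (hl m hm) => i; have := h (i - j)%R; rewrite subrK => <-.
by congr x; lia.
Qed.

Unset Implicit Arguments.
Set Strict Implicit.

Theorem theorem1p1 (R : realType) (A B C : finType)
    (X : set (fullshift A)) (Y : set (fullshift B)) (Z : set (fullshift C))
    (pi : fullshift A -> fullshift B)
    (hX : mixing_SFT X) (hY : mixing_sofic Y) (hpi : factor_code X Y pi)
    (hZ : subshift Z) (hent : (entropy R Z < entropy R Y)%E) :
  (exists Z' : set (fullshift A),
     [/\ subshift Z', Z' `<=` X, conjugate Z Z' & set_inj Z' pi])
  <->
  (forall n : nat, (1 <= n)%N ->
     periodic_points Z n #<=
     [set y | periodic_points Y n y /\
              exists2 x, periodic_points X n x & y = pi x]).
Proof.
have [[[clX shX] [F XF]] [g hg]] := hX.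
have [[pi_fun pi_cont pi_sh] pi_surj] := hpi.
have [clZ shZ] := hZ.
split=> [[Z' [[clZ' shZ'] Z'X [f [[f_fun _ f_sh] [_ f_inj _]]] pi_inj]] n n1|hcard].
  apply: (inj_card_le_fun (g := pi \o f)) => [z [Zz hz]|z z' [Zz _] [Zz' _] /= E].
    have hfz : least_period (f z) n.
      by apply: exact_period_code Zz hz => // x y Zx Zy; apply: f_inj; exact: mem_set.
    have Z'f : Z' (f z) := f_fun z Zz.
    split; last by exists (f z) => //; split=> //; exact: Z'X.
    split; first by apply: pi_fun; exact: Z'X.
    apply: (exact_period_code (S := Z')) => // x; first by move/Z'X; exact: pi_sh.
    by move=> y Zx Zy; apply: pi_inj; exact: mem_set.
  apply: f_inj; try exact: mem_set.
  by apply: pi_inj => //; apply: mem_set; exact: f_fun.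
case: (pselect (exists z, Z z)) => [exZ|noZ]; last first.
  have [y Yy] : exists y, Y y.
    case: (pselect (exists y, Y y)) => // nY.
    by move: hent; rewrite (entropy_set0 _ nY) ltNge leNye.
  have [x _ _] := pi_surj y Yy.
  exists set0; split=> //.
  - split; first exact: closed0.
    by rewrite image_set0.
  - have Z0 : Z = set0 by apply/seteqP; split=> // z Zz; apply: noZ; exists z.
    exists (fun=> x); rewrite Z0; split; split=> //.
      by apply/subspace_continuousP.
    by move=> z z'; rewrite inE.
  - by move=> z z'; rewrite inE.
have [[y0 Yy0] gap] := entropy_gap exZ hent.
have [x0 Xx0 _] := pi_surj y0 Yy0.
have [r hr] := uniform_window clX pi_cont.
pose l' := (\max_(w <- F) size w + (r + r))%N.
have l_big w : w \in F -> (size w <= l'.+1)%N.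
  move=> hw; have : (size w <= \max_(w <- F) size w)%N by exact: leq_bigmax_seq.
  by rewrite /l'; lia.
have r_l : (r + r < l'.+1)%N by rewrite /l'; lia.
have [conn [conn_walk size_conn]] := connections l' hg.
have [lam lamP] := label_exists shX XF l_big pi_sh hr r_l.
set G := (l'.+1 + g)%N in size_conn.
have G_gt0 : (0 < G)%N by rewrite /G; lia.
have [alpha _] := vertex_exists l' 0 Xx0.
have Z_shift (j : int) z : Z z -> Z (fun i => z (i + j)%R) by exact: subshift_translate.
have Z_closed x : (forall m : nat, exists z, Z z /\
  forall i : int, (`|i| <= m%:Z)%R -> z i = x i) -> Z x by exact: closed_cylinder.
(* A block is longer than its label word by two connections. *)
have [k [k_gt0 hk]] := gap (G + G)%N.
have more_labels : (#|words Z (G + G + k.-1)| + 3 <= #|labels (@edge A X l') lam k|)%N.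
  apply: (@leq_trans (num_words Z (k + (G + G)) + 3)).
    by rewrite leq_add2r -num_words_words card_words_leq //; lia.
  apply: leq_trans hk _; rewrite -num_words_words; apply: subset_leq_card.
  apply/fintype.subsetP => t; rewrite inE => /asboolP[y [j [Yy Et]]].
  have [x Xx Ey] := pi_surj y Yy.
  have [v [hv sv _]] := path_exists l' Xx.
  have hw := bipath_walk (j - r%:Z)%R k hv.
  have Ew : map lam (window v (j - r%:Z)%R k) = t.
    rewrite -window_map -Et -Ey -sv; apply: eq_window => i _.
    by rewrite lamP //; congr (pi _ _); lia.
  apply/labelsP => //.
  move: hw Ew; have := size_window v (j - r%:Z)%R k.
  case: (window v _ k) => [|s p] /= sz; first by rewrite -sz in k_gt0.
  rewrite rcons_path => /andP[_ /andP[hp _]] Ep.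
  by exists s, p; split=> //; rewrite -sz.
have small n : (0 < n)%N -> exists g : (int -> C) -> (int -> B),
    (forall z, Z z -> exact_period z n -> exact_period (g z) n /\
       exists x, [/\ bipath (@edge A X l') x, period n x & lam \o x = g z]) /\
    (forall z z', Z z -> exact_period z n -> Z z' -> exact_period z' n -> g z = g z' -> z = z').
  move=> n0; have [f [f1 f2]] := card_le_inj_fun y0 (hcard n n0).
  (* The label at i is the letter of Y at i + r. *)
  exists (fun z i => f z (i + r%:Z)%R); split=> [z Zz /exact_periodE hz|z z' Zz /exact_periodE hz Zz' /exact_periodE hz' E].
    have [[_ /exact_periodE hy] [x [Xx /exact_periodE hx] Ey]] := f1 z (conj Zz hz).
    split; first exact: exact_period_shift.
    have [v [hv sv vw]] := path_exists l' Xx.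
    exists v; split=> //.
      move=> i; apply/val_inj/val_inj; rewrite /= !vw.
      by apply: eq_window => q _; have [_ hp _] := hx; rewrite -[RHS]hp; congr x; lia.
    by apply/funext => i; rewrite /= lamP // sv Ey.
  apply: f2 => //; apply/funext => i; have := congr1 (fun h : int -> B => h (i - r%:Z)%R) E.
  by rewrite /= subrK.
have [psi [Q [psi_path psi_sh psi_local psi_inj]]] :=
  graph_embedding alpha G_gt0 conn_walk size_conn exZ Z_shift Z_closed k_gt0 more_labels small.
pose Psi (z : fullshift C) : fullshift A := spell (psi z).
have PsiX z : Z z -> X (Psi z) by move=> Zz; have := spell_in XF l_big (psi_path z Zz); exact.
have Psi_cont : {within Z, continuous Psi}.
  apply: (local_continuous (Q := Q)) => z z' i h.
  by rewrite /Psi /spell (psi_local z z' i h).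
have Psi_sh z : Psi (shift_map z) = shift_map (Psi z).
  by rewrite /Psi -[shift_map z]/(shiftZ z) psi_sh.
have piPsi_inj z z' : Z z -> Z z' -> pi (Psi z) = pi (Psi z') -> z = z'.
  move=> Zz Zz' E; apply: psi_inj => //; apply/funext => i /=.
  rewrite (lamP _ i (psi_path z Zz)) (lamP _ i (psi_path z' Zz')).
  exact: (congr1 (fun h : int -> B => h (i + r%:Z)%R) E).
exists (Psi @` Z); split.
- split; first exact: closed_image.
  apply/seteqP; split=> [_ [_ [z Zz <-] <-]|_ [z Zz <-]].
    exists (shift_map z); last exact: Psi_sh.
    by rewrite -shZ; exists z.
  move: Zz; rewrite -{1}shZ => -[z0 Zz0 <-].
  by exists (Psi z0); [exists z0 | rewrite Psi_sh].
- by move=> _ [z Zz <-]; exact: PsiX.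
- have Psi_fun : set_fun Z (Psi @` Z) Psi by move=> z Zz; exists z.
  exists Psi; split; split=> // z z' /set_mem Zz /set_mem Zz' E.
  by apply: piPsi_inj => //; rewrite E.
- by move=> _ _ /set_mem[z Zz <-] /set_mem[z' Zz' <-] E; rewrite (piPsi_inj z z').
Qed.
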